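(* There is an algorithm that solves each instance $(G,k,\mathcal{X},\mathcal{U})$ of Set-Restricted Disjoint Paths, where $G$ is a connected well-partitioned chordal graph on $n$ vertices given along with a partition tree $\mathcal{T}$, in time $2^{\mathcal{O}(k\log k)}\cdot n$.
   Context: All graphs are finite, simple and undirected. A connected graph $G$ is a well-partitioned chordal graph if there exist a partition $\mathcal{P}$ of $V(G)$ and a tree $\mathcal{T}$ with vertex set $\mathcal{P}$ such that: (i) each part $X\in\mathcal{P}$ is a clique in $G$; (ii) for each edge $XY\in E(\mathcal{T})$ there are $X'\subseteq X$ and $Y'\subseteq Y$ such that the edges of $G$ between $X$ and $Y$ are exactly the pairs $xy$ with $x\in X'$, $y\in Y'$; (iii) for distinct $X,Y\in\mathcal{P}$ with $XY\notin E(\mathcal{T})$, there are no edges of $G$ between $X$ and $Y$. Such a $\mathcal{T}$ is a partition tree of $G$. Two paths, an $(s_1,t_1)$-path $P_1$ and an $(s_2,t_2)$-path $P_2$, are internally vertex-disjoint if for $i\in\{1,2\}$, $(V(P_i)\setminus\{s_i,t_i\})\cap V(P_{3-i})=\emptyset$. Set-Restricted Disjoint Paths: the input is a graph $G$, a set $\mathcal{X}=\{(s_1,t_1),\dots,(s_k,t_k)\}$ of $k$ pairs of vertices of $G$ (terminals; different indices may have the same pair), and $\mathcal{U}=\{U_1,\dots,U_k\}$ of $k$ vertex subsets of $G$ (domains). The question is whether $G$ contains $k$ pairwise internally vertex-disjoint paths $P_1,\dots,P_k$ such that for each $i\in\{1,\dots,k\}$, $P_i$ is an $(s_i,t_i)$-path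 with $V(P_i)\subseteq U_i$.
   Formalization: The partition tree is given together with a table of the sets X', Y' of each tree edge; with only the adjacency matrix of G and T, time linear in n is impossible (two cliques joined by one hidden edge need quadratically many probes). *)

(* Defs.v *)
From mathcomp Require Import all_boot.

Set Implicit Arguments.
Unset Strict Implicit.
Unset Printing Implicit Defensive.

Section Graphs.
Variable W : finType.
Implicit Types (S : {set W}) (g : rel W).

(* g is the adjacency relation of a simple undirected graph with vertex set S *)
Definition simple_graph S g : Prop :=
  [/\ symmetric g, irreflexive g
    & forall x y, g x y -> (x \in S) && (y \in S)].

Definition connected_graph S g : Prop :=
  S != set0 /\ {in S &, forall x y, connect g x y}.

Definition acyclic_graph g : Prop :=
  forall c : seq W, cycle g c -> uniq c -> size c <= 2.

Definition tree S g : Prop :=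
  [/\ simple_graph S g, connected_graph S g & acyclic_graph g].

(* q is the vertex sequence of an (s,t)-path; when s = t this is [:: s] *)
Definition st_path g (s t : W) (q : seq W) : Prop :=
  [/\ sorted g q, uniq q, ohead q = Some s & last s q = t].

Definition internally_disjoint (st1 : W * W) (q1 : seq W)
    (st2 : W * W) (q2 : seq W) : Prop :=
  (forall x, x \in q1 -> x != st1.1 -> x != st1.2 -> x \notin q2) /\
  (forall x, x \in q2 -> x != st2.1 -> x != st2.2 -> x \notin q1).

End Graphs.

Section WellPartitionedChordal.
Variable V : finType.
Implicit Types (e : rel V) (P : {set {set V}}) (T : rel {set V}).

Definition partition_tree e P T : Prop :=
  [/\ partition P [set: V],
      tree P T,
      forall X, X \in P -> {in X &, forall x y, x != y -> e x y},
      forall X Y, T X Y ->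
        exists X' Y' : {set V}, [/\ X' \subset X, Y' \subset Y
          & {in X & Y, forall x y, e x y = (x \in X') && (y \in Y')}]
    & forall X Y, X \in P -> Y \in P -> X != Y -> ~~ T X Y ->
        {in X & Y, forall x y, ~~ e x y}].

Definition well_partitioned_chordal e : Prop :=
  [/\ simple_graph [set: V] e, connected_graph [set: V] e
    & exists P T, partition_tree e P T].

(* Boundary of X towards Y.  For an edge XY of a partition tree of a connected
   graph, X' = boundary e X Y and Y' = boundary e Y X are the only sets
   witnessing the fourth clause of partition_tree. *)
Definition boundary e (X Y : {set V}) : {set V} :=
  [set x in X | [exists y in Y, e x y]].

End WellPartitionedChordal.

Definition set_restricted_disjoint_paths (V : finType) (e : rel V) (k : nat)
    (X : 'I_k -> V * V) (U : 'I_k -> {set V}) : Prop :=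
  exists Q : 'I_k -> seq V,
    (forall i, st_path e (X i).1 (X i).2 (Q i) /\ {subset Q i <= U i}) /\
    (forall i j, i != j -> internally_disjoint (X i) (Q i) (X j) (Q j)).

(* A random access machine with scalar registers and arrays, both named by
   numerals that are fixed in the program text, so that a program uses finitely
   many of each; array cells are addressed by computed indices. *)

Inductive binop := Add | Sub | Mul | Div | Mod | Eq | Lt.

Definition eval_binop (o : binop) (a b : nat) : nat :=
  match o with
  | Add => a + b
  | Sub => a - b
  | Mul => a * b
  | Div => a %/ b
  | Mod => a %% b
  | Eq => a == b
  | Lt => a < b
  end.

Inductive expr :=
  | Const of nat
  | Reg of nat
  | Read of nat & expr              (* array, index *)
  | Binop of binop & expr & expr.

Inductive cmd :=
  | Skip
  | Assign of nat & expr            (* register, value *)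
  | Write of nat & expr & expr      (* array, index, value *)
  | Seq of cmd & cmd
  | If of expr & cmd & cmd
  | While of expr & cmd.

Record state := State { reg : nat -> nat; arr : nat -> nat -> nat }.

Fixpoint eval (m : state) (a : expr) : nat :=
  match a with
  | Const c => c
  | Reg x => reg m x
  | Read r i => arr m r (eval m i)
  | Binop o a1 a2 => eval_binop o (eval m a1) (eval m a2)
  end.

Definition set_reg (m : state) (x v : nat) : state :=
  State (fun y => if y == x then v else reg m y) (arr m).

Definition set_arr (m : state) (r i v : nat) : state :=
  State (reg m)
    (fun r' j => if (r' == r) && (j == i) then v else arr m r' j).

(* [exec B p m t m']: started in memory m, the program p halts after t unit-cost
   steps in memory m', and every word it writes, and every address it writes to,
   is below B.  A command that would exceed B has no execution.  The expressions
   in a program have constant size, so charging one step per command, test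
   included, changes the running time of a program by a constant factor only,
   and intermediate values are at most polynomial in B. *)
Inductive exec (B : nat) : cmd -> state -> nat -> state -> Prop :=
  | ExecSkip m : exec B Skip m 1 m
  | ExecAssign x a m :
      eval m a < B -> exec B (Assign x a) m 1 (set_reg m x (eval m a))
  | ExecWrite r i a m :
      eval m i < B -> eval m a < B ->
      exec B (Write r i a) m 1 (set_arr m r (eval m i) (eval m a))
  | ExecSeq p1 p2 m1 t1 m2 t2 m3 :
      exec B p1 m1 t1 m2 -> exec B p2 m2 t2 m3 ->
      exec B (Seq p1 p2) m1 (t1 + t2) m3
  | ExecIfTrue a p1 p2 m t m' :
      eval m a != 0 -> exec B p1 m t m' -> exec B (If a p1 p2) m t.+1 m'
  | ExecIfFalse a p1 p2 m t m' :
      eval m a = 0 -> exec B p2 m t m' -> exec B (If a p1 p2) m t.+1 m'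
  | ExecWhileTrue a p m1 t1 m2 t2 m3 :
      eval m1 a != 0 -> exec B p m1 t1 m2 -> exec B (While a p) m2 t2 m3 ->
      exec B (While a p) m1 (t1 + t2).+1 m3
  | ExecWhileFalse a p m :
      eval m a = 0 -> exec B (While a p) m 1 m.

Section Encoding.
Variables (n k : nat).
Notation V := 'I_n.
Implicit Types (e : rel V) (P : {set {set V}}) (T : rel {set V}).
Implicit Types (Ps : seq {set V}) (Es : seq ({set V} * {set V})).

Definition enumerates_parts P Ps : Prop := uniq Ps /\ Ps =i P.

(* Es lists each (unordered) edge of T once, in one of its two orientations *)
Definition enumerates_edges T Es : Prop :=
  [/\ uniq Es,
      forall X Y, T X Y = ((X, Y) \in Es) || ((Y, X) \in Es)
    & forall X Y, (X, Y) \in Es -> (Y, X) \notin Es].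

(* Two-dimensional tables are stored in row-major order with rows of length n:
   - array 0, cell v         : the position in Ps of the part containing v;
   - arrays 1 and 2, cell i  : the terminals s_i and t_i;
   - array 3, cell i * n + v : whether v belongs to U_i;
   - array 4, cell u * n + v : whether uv is an edge of G;
   - arrays 5 and 6, cell j  : the positions in Ps of the two ends X, Y of the
                               j-th edge of the partition tree;
   - array 7, cell j * n + v : whether v belongs to X' or Y', for that edge.
   The boundaries X', Y' are part of the given partition tree: recovering them
   from the adjacency matrix alone needs quadratically many probes in general. *)
Definition input_array e (X : 'I_k -> V * V) (U : 'I_k -> {set V}) Ps Es
    (r : nat) : seq nat :=
  match r with
  | 0 => [seq find (fun A : {set V} => v \in A) Ps | v <- enum V]
  | 1 => [seq val (X i).1 | i <- enum 'I_k]
  | 2 => [seq val (X i).2 | i <- enum 'I_k]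
  | 3 => [seq nat_of_bool (v \in U i) | i <- enum 'I_k, v <- enum V]
  | 4 => [seq nat_of_bool (e u v) | u <- enum V, v <- enum V]
  | 5 => [seq index E.1 Ps | E <- Es]
  | 6 => [seq index E.2 Ps | E <- Es]
  | 7 => [seq nat_of_bool (v \in boundary e E.1 E.2 :|: boundary e E.2 E.1)
            | E <- Es, v <- enum V]
  | _ => [::]
  end.

(* registers 0, 1, 2 hold n, k and the number of parts *)
Definition input e (X : 'I_k -> V * V) (U : 'I_k -> {set V}) Ps Es : state :=
  State (nth 0 [:: n; k; size Ps])
        (fun r => nth 0 (input_array e X U Ps Es r)).

End Encoding.

Definition bigO (f g : nat -> nat) : Prop :=
  exists C k0, forall k, k0 <= k -> f k <= C * g k.

(* Main.v *)
Require Import Defs.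
From mathcomp Require Import all_boot.
From mathcomp Require Import zify.

(** Let path i of a solution run from s_i to t_i.  A walk in the graph induces a walk
    in the partition tree, hence it crosses every tree edge that separates the bags
    of s_i and t_i, in the direction from s_i to t_i.  Conversely, suppose that for
    each of these crossings a vertex has been chosen in the boundary on either side.
    Bags are cliques and the two boundaries of a tree edge are completely joined, so
    that the chosen vertices and the two terminals induce a connected subgraph, which
    contains a path from s_i to t_i.  The crossings do not depend on the solution, so
    the instance splits into independent problems, one for each bag: fill the at most
    2 k active slots of the bag, two for each path, with vertices of the right domain
    and boundary, so that different paths share no vertex except terminals that end
    them both (feasible_of_paths, paths_of_feasible).

    In a single bag brute force is fast enough after a reduction.  Keep, for each pair
    of slots, the first 2 k vertices that are allowed in both.  A vertex outside this
    kernel can be exchanged for one inside it, since a choice uses at most 2 k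
    vertices and so leaves one of the candidates free (exchange).  The kernel has at
    most 8 k^3 vertices, and trying (8 k^3 + 1)^(2k) choices takes 2^O(k log k) steps.

    The crossings are found in linear time by stripping leaves off the tree.  The
    degree of a bag together with the sum of the numbers of its remaining edges is
    enough to detach a leaf.  Along the order of removal, a token is moved from the
    bag of each terminal: it slides to the neighbour whenever its bag is removed, and
    an edge separates s_i from t_i exactly when it is removed while just one of the
    two tokens sits on its leaf (crossing_walk, crossings_connect).

    The program is verified in a small logic of total correctness with running times
    (algorithm_ok): its answer is a function of the input arrays and of the order of
    removal, and answerP identifies this answer with the existence of the paths. *)

Set Implicit Arguments.
Unset Strict Implicit.
Unset Printing Implicit Defensive.

(** * Program logic with running times *)

(** Total correctness in continuation form.  The time is only bounded from above,
    so that branches of different lengths can be merged. *)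
Definition runs B c m t (Q : state -> Prop) :=
  exists t' m', [/\ exec B c m t' m', t' <= t & Q m'].

Fixpoint wreg c : seq nat :=
  match c with
  | Assign x _ => [:: x]
  | Seq c1 c2 | If _ c1 c2 => wreg c1 ++ wreg c2
  | While _ c1 => wreg c1
  | _ => [::]
  end.

Fixpoint warr c : seq nat :=
  match c with
  | Write r _ _ => [:: r]
  | Seq c1 c2 | If _ c1 c2 => warr c1 ++ warr c2
  | While _ c1 => warr c1
  | _ => [::]
  end.

(** What a command leaves unchanged is read off its text; loop invariants then
    speak only of what the loop writes. *)
Definition frame c m m' :=
  (forall x, x \notin wreg c -> reg m' x = reg m x) /\
  (forall r, r \notin warr c -> arr m' r = arr m r).

Lemma exec_frame B c m t m' : exec B c m t m' -> frame c m m'.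
Proof.
elim=> {c m t m'} //=.
- by move=> x a m _; split=> //= y; rewrite inE => /negbTE->.
- by move=> r i a m _ _; split=> //= y; rewrite inE => /negbTE->.
- move=> c1 c2 m1 t1 m2 t2 m3 _ [R1 A1] _ [R2 A2].
  by split=> x; rewrite mem_cat => /norP[x1 x2]; rewrite (R2, A2) ?(R1, A1).
- move=> a c1 c2 m t m' _ _ [R A].
  by split=> x; rewrite mem_cat => /norP[x1 x2]; rewrite (R, A).
- move=> a c1 c2 m t m' _ _ [R A].
  by split=> x; rewrite mem_cat => /norP[x1 x2]; rewrite (R, A).
- move=> a c m1 t1 m2 t2 m3 _ _ [R1 A1] _ [R2 A2].
  by split=> x xc; rewrite (R2, A2) ?(R1, A1).
Qed.

Lemma runs_frame B c m t Q :
  runs B c m t (fun m' => frame c m m' -> Q m') -> runs B c m t Q.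
Proof. by case=> t' [m' [E T HQ]]; exists t', m'; split; last exact/HQ/(exec_frame E). Qed.

Lemma runs_weaken B c m t t' (Q Q' : state -> Prop) :
  runs B c m t Q -> t <= t' -> (forall m', Q m' -> Q' m') -> runs B c m t' Q'.
Proof.
by case=> u [m' [E T HQ]] tt' QQ'; exists u, m'; split=> //; [lia | apply: QQ'].
Qed.

Lemma runs_skip B m t (Q : state -> Prop) : Q m -> runs B Skip m t.+1 Q.
Proof. by move=> HQ; exists 1, m; split=> //; constructor. Qed.

Lemma runs_assign B x a m t (Q : state -> Prop) :
  eval m a < B -> Q (set_reg m x (eval m a)) -> runs B (Assign x a) m t.+1 Q.
Proof. by move=> aB HQ; exists 1, (set_reg m x (eval m a)); split=> //; constructor. Qed.

Lemma runs_write B r i a m t (Q : state -> Prop) :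
  eval m i < B -> eval m a < B -> Q (set_arr m r (eval m i) (eval m a)) ->
  runs B (Write r i a) m t.+1 Q.
Proof.
move=> iB aB HQ; exists 1, (set_arr m r (eval m i) (eval m a)).
by split=> //; constructor.
Qed.

Lemma runs_seq B c1 c2 m t1 t2 Q :
  runs B c1 m t1 (fun m' => runs B c2 m' t2 Q) -> runs B (Seq c1 c2) m (t1 + t2) Q.
Proof.
case=> u1 [m1 [E1 T1 [u2 [m2 [E2 T2 HQ]]]]].
by exists (u1 + u2), m2; split=> //; [apply: ExecSeq E1 E2 | lia].
Qed.

Lemma runs_if B a c1 c2 m t Q :
  (eval m a != 0 -> runs B c1 m t Q) -> (eval m a = 0 -> runs B c2 m t Q) ->
  runs B (If a c1 c2) m t.+1 Q.
Proof.
move=> H1 H2; case: (eqVneq (eval m a) 0) => a0.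
  have [u [m' [E T HQ]]] := H2 a0.
  by exists u.+1, m'; split=> //; apply: ExecIfFalse.
have [u [m' [E T HQ]]] := H1 a0.
by exists u.+1, m'; split=> //; apply: ExecIfTrue.
Qed.

(** The iteration number x is a ghost: it lives in no register, so that a loop may
    run more often than the largest machine word. *)
Lemma runs_while B a c m b N (I : nat -> state -> Prop) (Q : state -> Prop) :
  I 0 m ->
  (forall x m', x < N -> I x m' -> eval m' a != 0 /\ runs B c m' b (I x.+1)) ->
  (forall m', I N m' -> eval m' a = 0 /\ Q m') ->
  runs B (While a c) m (N * b.+1 + 1) Q.
Proof.
move=> I0 body fin.
suff: forall y x m', x + y = N -> I x m' -> runs B (While a c) m' (y * b.+1 + 1) Q.
  by move=> H; apply: (H N 0).
elim=> [|y IHy] x m' xyN Ix.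
  rewrite addn0 in xyN; rewrite xyN in Ix; have [a0 HQ] := fin _ Ix.
  by exists 1, m'; split=> //; apply: ExecWhileFalse.
have [|a0 [u1 [m1 [E1 T1 I1]]]] := body x m' _ Ix; first lia.
have [|u2 [m2 [E2 T2 HQ]]] := IHy x.+1 m1 _ I1; first lia.
by exists (u1 + u2).+1, m2; split=> //; [apply: ExecWhileTrue a0 E1 E2 | lia].
Qed.

Lemma natb_neq0 (b : bool) : (b : nat) != 0 -> b. Proof. by case: b. Qed.
Lemma natb_eq0 (b : bool) : (b : nat) = 0 -> ~~ b. Proof. by case: b. Qed.

(** In an expression a bare numeral names a register; constants are written #c. *)
Coercion Reg : nat >-> expr.
Declare Scope expr_scope.
Bind Scope expr_scope with expr.
Delimit Scope expr_scope with X.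
Declare Scope cmd_scope.
Bind Scope cmd_scope with cmd.
Delimit Scope cmd_scope with C.
Arguments Read r%_N i%_X.
Arguments Binop o a%_X b%_X.
Arguments Assign x%_N a%_X.
Arguments Write r%_N i%_X a%_X.
Arguments Seq c1%_C c2%_C.
Arguments If a%_X c1%_C c2%_C.
Arguments While a%_X c%_C.
Notation "# c" := (Const c) (at level 1, format "# c") : expr_scope.
Notation "r .[ i ]" := (Read r%N i%X) : expr_scope.
Notation "a + b" := (Binop Add a b) : expr_scope.
Notation "a - b" := (Binop Defs.Sub a b) : expr_scope.
Notation "a * b" := (Binop Mul a b) : expr_scope.
Notation "a %/ b" := (Binop Div a b) : expr_scope.
Notation "a %% b" := (Binop Mod a b) : expr_scope.
Notation "a == b" := (Binop Eq a b) : expr_scope.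
Notation "a < b" := (Binop Lt a b) : expr_scope.
Notation "x ::= a" := (Assign x a) (at level 60, a at level 70) : cmd_scope.
Notation "r `[ i ] ::= a" := (Write r i a) (at level 60, i at level 200, a at level 70) : cmd_scope.
Notation "c1 ;; c2" := (Seq c1 c2) (at level 75, right associativity) : cmd_scope.

Definition For (x : nat) (N : expr) (c : cmd) : cmd :=
  (x ::= #0 ;; While (x < N) (c ;; x ::= x + #1))%C.
Arguments For x%_N N%_X c%_C.

(** The bound Ne is evaluated again at each round, whence the requirement that it
    keeps its value along the frame of the loop. *)
Lemma runs_for B x Ne c m0 N b (I : nat -> state -> Prop) (Q : state -> Prop) :
  x \notin wreg c -> N < B ->
  (forall m, frame (For x Ne c) m0 m -> eval m Ne = N) ->
  I 0 (set_reg m0 x 0) ->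
  (forall i m, i < N -> frame (For x Ne c) m0 m -> reg m x = i -> I i m ->
     runs B c m b (fun m' => I i.+1 (set_reg m' x i.+1))) ->
  (forall m, frame (For x Ne c) m0 m -> I N m -> Q m) ->
  runs B (For x Ne c) m0 (N * b.+2 + 2) Q.
Proof.
move=> xc NB evN I0 step fin.
have E : N * b.+2 + 2 = 1 + (N * b.+2 + 1) by lia.
rewrite E; apply/runs_seq/runs_assign; first by rewrite /=; lia.
set J := fun i m => [/\ frame (For x Ne c) m0 m, reg m x = i & I i m].
have ord m1 m2 i : frame (For x Ne c) m0 m1 -> frame c m1 m2 ->
    frame (For x Ne c) m0 (set_reg m2 x i).
  case=> R1 A1 [R2 A2]; split=> [y|r].
    rewrite /= inE mem_cat !inE => /norP[yx /norP[yc _]] /=.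
    by rewrite (negbTE yx) R2 // R1 // /= inE mem_cat !inE (negbTE yx) (negbTE yc).
  rewrite /= cats0 => rc.
  by rewrite A2 // A1 //= cats0.
apply: (@runs_while _ _ _ _ _ _ J).
- split=> //=; last by rewrite eqxx.
  by split=> [y|r] //=; rewrite inE => /norP[/negbTE-> _].
- move=> i m iN [fr ri Ii]; split; first by rewrite /= ri evN // iN.
  have -> : b.+1 = b + 1 by lia.
  have [t' [m' [E' T' H']]] := step i m iN fr ri Ii.
  have fc := exec_frame E'.
  apply/runs_seq; exists t', m'; split=> //.
  have ri' : reg m' x = i by case: fc => -> //.
  apply: runs_assign => /=; rewrite ?ri' ?addn1; first by lia.
  by split=> //=; [apply: ord fr fc | rewrite eqxx].
- move=> m [fr ri IN]; split; first by rewrite /= ri evN // ltnn.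
  exact: fin.
Qed.

(** * Counting and positional notation *)

Lemma iotaSr v : iota 0 v.+1 = rcons (iota 0 v) v.
Proof. by rewrite -addn1 iotaD cats1. Qed.

(** Both halves of the kernel argument rest on this count: it bounds the number of
    vertices that are kept, and it shows that b of them were kept before the first
    one was refused. *)
Lemma count_first (P : pred nat) b v :
  count (fun x => P x && (count P (iota 0 x) < b)) (iota 0 v) = minn b (count P (iota 0 v)).
Proof.
elim: v => [|v IHv]; first by rewrite minn0.
rewrite iotaSr -!cats1 !count_cat IHv /= !addn0.
by case: (P v) => /=; lia.
Qed.

Lemma leq_count_has (I J : Type) (Q : I -> J -> bool) xs zs :
  count (fun x => has (Q^~ x) zs) xs <= \sum_(z <- zs) count (Q z) xs.
Proof.
elim: zs => [|z zs IH]; first by rewrite big_nil /= count_pred0.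
rewrite big_cons; apply: leq_trans (leq_add (leqnn _) IH).
rewrite -count_predUI; apply: leq_trans (leq_addr _ _).
by apply: sub_count => x.
Qed.

Lemma minn_succ a b : b < a -> minn a b + 1 = minn a (b + 1).
Proof. by lia. Qed.

Lemma pair_lt p d m w : p < m -> d < w -> p * w + d < m * w.
Proof. by nia. Qed.

Lemma pair_inj p d p' d' w : d < w -> d' < w ->
  (p * w + d == p' * w + d') = (p == p') && (d == d').
Proof.
move=> dw d'w; have w0 : 0 < w by lia.
apply/eqP/andP => [E|[/eqP-> /eqP->] //].
have := congr1 (modn^~ w) E; have := congr1 (divn^~ w) E.
by rewrite /= !divnMDl // !divn_small // !addn0 !modnMDl !modn_small // => -> ->.
Qed.

Definition digit b x i := x %/ b ^ i %% b.

(** Adding one: position i moves exactly when all lower positions overflow, and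
    that is the divisibility of the new number by b ^ i. *)
Lemma digitS b x i : 0 < b -> digit b x.+1 i = (digit b x i + (b ^ i %| x.+1)) %% b.
Proof. by move=> b0; rewrite /digit divnS ?expn_gt0 ?b0 // modnDml addnC. Qed.

Lemma carryS b x i : 0 < b ->
  (b ^ i.+1 %| x) = (b ^ i %| x) && (digit b x i == 0).
Proof.
move=> b0; rewrite expnS; case: (boolP (b ^ i %| x)) => [bx|nbx] /=.
  by rewrite -dvdn_divRL.
by apply: contraNF nbx; apply: dvdn_trans; rewrite dvdn_mull.
Qed.

(** * Memory layout and input *)

(** The number M of bags is in register rM.  The work arrays hold
    - aTerm, cell v: whether v is a terminal;
    - aDeg and aSum, cell p: the number of remaining tree edges at the bag p, and
      the sum of the numbers of these edges;
    - aLeaf, aNbr and aEdge, cell a: the leaf removed at step a, its neighbour, and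
      the edge between them;
    - aSlot, cell (2 * i + 1) * n + p, resp. 2 * i * n + p: one more than the number
      of the tree edge by which path i leaves, resp. enters, the bag p, and 0 if
      there is none;
    - aAllow, cell sg * n + v: whether v may serve in the slot sg of its bag;
    - aCount, cell p * (4 * k * k) + z: the number of vertices of p seen so far that
      are allowed in both slots of the pair coded by z, capped at 2 * k;
    - aKer, row p, and aSize, cell p: the kernel of the bag p and its size;
    - aDigit, cell sg: the position in the kernel of the vertex tried in slot sg. *)
Notation rN := 0%N (only parsing).
Notation rK := 1%N (only parsing).
Notation rM := 2%N (only parsing).
Notation xI := 3%N (only parsing).
Notation xJ := 4%N (only parsing).
Notation xV := 5%N (only parsing).
Notation xW := 6%N (only parsing).
Notation xU := 7%N (only parsing).
Notation xE := 8%N (only parsing).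
Notation xLen := 9%N (only parsing).
Notation xC := 10%N (only parsing).
Notation xD := 11%N (only parsing).
Notation xP := 12%N (only parsing).
Notation xMark := 13%N (only parsing).
Notation xRes := 14%N (only parsing).
Notation xFound := 15%N (only parsing).
Notation xOk := 16%N (only parsing).
Notation xCarry := 17%N (only parsing).

Notation aBag := 0%N (only parsing).
Notation aS := 1%N (only parsing).
Notation aT := 2%N (only parsing).
Notation aDom := 3%N (only parsing).
Notation aX := 5%N (only parsing).
Notation aY := 6%N (only parsing).
Notation aBd := 7%N (only parsing).
Notation aTerm := 8%N (only parsing).
Notation aDeg := 9%N (only parsing).
Notation aSum := 10%N (only parsing).
Notation aLeaf := 11%N (only parsing).
Notation aNbr := 12%N (only parsing).
Notation aEdge := 13%N (only parsing).
Notation aSlot := 14%N (only parsing).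
Notation aAllow := 15%N (only parsing).
Notation aCount := 16%N (only parsing).
Notation aKer := 17%N (only parsing).
Notation aSize := 18%N (only parsing).
Notation aDigit := 19%N (only parsing).

Section Machine.
Variables (n k M B : nat).
Variables (bag s t dom ex ey bd : nat -> nat).
Hypothesis leMn : M <= n.
Hypothesis bag_lt : forall v, v < n -> bag v < M.
Hypothesis s_lt : forall i, i < k -> s i < n.
Hypothesis t_lt : forall i, i < k -> t i < n.
Hypothesis ex_lt : forall j, j < M -> ex j < M.
Hypothesis ey_lt : forall j, j < M -> ey j < M.
(** The written tables have at most n rows of width at most 8 k^3 + 1, or one row of
    length n for each slot, and sums of edge numbers are at most n^2. *)
Hypothesis B_gt : n.+2 * n.+2 * (8 * k ^ 3 + 4 * k ^ 2 + 2 * k + 2) < B.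

Lemma square_bound : n.+2 * n.+2 < B. Proof using B_gt. clear -B_gt; nia. Qed.
Lemma n_bound : n.+2 < B. Proof using B_gt. clear -B_gt; have := square_bound; nia. Qed.
Lemma k_bound : 2 * k + 2 < B. Proof using B_gt. clear -B_gt; nia. Qed.

Lemma table_bound w p d : w <= 8 * k * k * k + 4 * k * k + 2 * k + 2 ->
  p < n -> d < w -> p * w + d < B.
Proof using B_gt.
clear -B_gt; move=> wk pn dw; apply: leq_ltn_trans B_gt.
have -> : 8 * k ^ 3 + 4 * k ^ 2 + 2 * k + 2 = 8 * k * k * k + 4 * k * k + 2 * k + 2.
  by rewrite !expnS expn0; lia.
move: (8 * k * k * k + _ + _ + _) wk => C wk; nia.
Qed.

Lemma width_bound : 8 * k * k * k + 4 * k * k + 2 * k + 2 < B.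
Proof using B_gt.
clear -B_gt; apply: leq_ltn_trans B_gt.
have -> : 8 * k ^ 3 + 4 * k ^ 2 + 2 * k + 2 = 8 * k * k * k + 4 * k * k + 2 * k + 2.
  by rewrite !expnS expn0; lia.
move: (8 * k * k * k + _ + _ + _) => C; nia.
Qed.

Lemma count_bound p d : p < n -> d < 4 * k * k -> p * (4 * k * k) + d < B.
Proof using B_gt. by apply: table_bound; rewrite -!addnA addnCA leq_addr. Qed.

Lemma kernel_bound p d :
  p < n -> d < 8 * k * k * k + 1 -> p * (8 * k * k * k + 1) + d < B.
Proof using B_gt. by apply: table_bound; clear; rewrite -!addnA leq_add2l; lia. Qed.

Lemma loop_bound : 4 * k * k < B.
Proof using B_gt.
by apply: leq_ltn_trans width_bound; clear; rewrite -!addnA addnCA leq_addr.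
Qed.

Lemma base_bound : 8 * k * k * k + 2 < B.
Proof using B_gt.
apply: leq_ltn_trans width_bound; clear; rewrite -!addnA leq_add2l; lia.
Qed.

Definition holds_input m :=
  [/\ reg m rN = n, reg m rK = k & reg m rM = M] /\
  [/\ arr m aBag = bag, arr m aS = s, arr m aT = t & arr m aDom = dom] /\
  [/\ arr m aX = ex, arr m aY = ey & arr m aBd = bd].

Lemma frame_input c m m' :
  [&& rN \notin wreg c, rK \notin wreg c & rM \notin wreg c] ->
  all (fun a => a \notin warr c) [:: aBag; aS; aT; aDom; aX; aY; aBd] ->
  frame c m m' -> holds_input m -> holds_input m'.
Proof.
case/and3P=> r0 r1 r2 /= /and5P[a0 a1 a2 a3 /and4P[a5 a6 a7 _]] [R A].
by rewrite /holds_input !R // !A.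
Qed.

(** * Marking the terminals *)

Definition mark_terminals : cmd :=
  For xI rK (aTerm`[aS.[xI]] ::= #1 ;; aTerm`[aT.[xI]] ::= #1).

Definition terminals i v := has (fun i => (s i == v) || (t i == v)) (iota 0 i).

Lemma mark_terminals_ok m :
  holds_input m -> (forall v, arr m aTerm v = 0) ->
  runs B mark_terminals m (k * 4 + 2) (fun m' => forall v, arr m' aTerm v = terminals k v).
Proof.
move=> inp T0.
have k_bound := k_bound; have n_bound := n_bound.
pose I i m' := forall v, arr m' aTerm v = terminals i v.
apply: (@runs_for _ _ _ _ _ k 2 I) => //; first lia.
- by move=> m' fr; case: (frame_input _ _ fr inp) => // -[].
- move=> i m' ik fr mi Ii.
  have [[mn mk mM] [[mbag ms mt mdom] [mx my mbd]]] : holds_input m' by apply: frame_input fr inp.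
  apply: (@runs_seq _ _ _ _ 1 1); apply: runs_write; rewrite /= ?mi ?ms.
  + by have := s_lt ik; lia.
  + lia.
  apply: runs_write; rewrite /= ?mi ?mt.
  + by have := t_lt ik; lia.
  + lia.
  move=> v /=; rewrite Ii /terminals -[in RHS]addn1 iotaD has_cat /= orbF add0n.
  by rewrite ![v == _]eq_sym; case: (t i == v); case: (s i == v); rewrite ?orbT ?orbF.
Qed.

(** * Counting the tree edges at each bag *)

Definition count_edges : cmd :=
  For xI rM (If (aX.[xI] == aY.[xI]) Skip
    (aDeg`[aX.[xI]] ::= aDeg.[aX.[xI]] + #1 ;;
     aDeg`[aY.[xI]] ::= aDeg.[aY.[xI]] + #1 ;;
     aSum`[aX.[xI]] ::= aSum.[aX.[xI]] + xI ;;
     aSum`[aY.[xI]] ::= aSum.[aY.[xI]] + xI)).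

(** The array cells beyond the last tree edge are 0 at both ends, whereas an edge
    joins two distinct bags: ex j = ey j tells that there is no edge j. *)
Definition inc j p : bool := (ex j != ey j) && ((p == ex j) || (p == ey j)).
Definition deg (F : pred nat) p := \sum_(j < M | F j) inc j p.
(** At a bag with one remaining edge this sum is the number of that edge, so that
    leaves can be detached without adjacency lists. *)
Definition edge_sum (F : pred nat) p := \sum_(j < M | F j) inc j p * j.

Lemma count_edges_ok m :
  holds_input m -> (forall p, arr m aDeg p = 0) -> (forall p, arr m aSum p = 0) ->
  runs B count_edges m (M * 7 + 2) (fun m' =>
    forall p, arr m' aDeg p = deg predT p /\ arr m' aSum p = edge_sum predT p).
Proof.
move=> inp D0 S0.
have B1 := square_bound; have n_bound := n_bound.
pose I i m' := forall p, arr m' aDeg p = \sum_(0 <= j < i) inc j p /\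
   arr m' aSum p = \sum_(0 <= j < i) inc j p * j.
have degB i p : i < M -> \sum_(0 <= j < i) inc j p + 2 < B.
  move=> iM; have : \sum_(0 <= j < i) inc j p <= \sum_(0 <= j < i) 1.
    by apply: leq_sum => j _; case: (inc j p).
  by rewrite sum_nat_const_nat; lia.
have sumB i p : i < M -> \sum_(0 <= j < i) inc j p * j + i + i < B.
  move=> iM; have : \sum_(0 <= j < i) inc j p * j <= \sum_(0 <= j < i) i.
    rewrite !big_nat; apply: leq_sum => j ji; case: (inc j p); lia.
  by rewrite sum_nat_const_nat; nia.
apply: (@runs_for _ _ _ _ _ M 5 I) => //; first lia.
- by move=> m' fr; case: (frame_input _ _ fr inp) => // -[].
- by move=> p /=; rewrite !big_geq.
- move=> i m' iM fr mi Ii.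
  have [_ [_ [mx my _]]] : holds_input m' by apply: frame_input fr inp.
  have [xi yi] := (ex_lt iM, ey_lt iM).
  apply: runs_if; rewrite /= mi mx my => exy.
    apply: runs_skip.
    move=> p /=; have [-> ->] := Ii p.
    have {}exy : ex i == ey i by case: (ex i == ey i) exy.
    by rewrite !big_nat_recr //= /inc exy ?mul0n !addn0.
  have {exy}nxy : ex i != ey i by case: (ex i == ey i) exy.
  have [] := (degB i (ex i) iM, degB i (ey i) iM).
  have [] := (sumB i (ex i) iM, sumB i (ey i) iM).
  rewrite -!(proj1 (Ii _)) -!(proj2 (Ii _)) => S1 S2 D1 D2.
  apply: (@runs_seq _ _ _ _ 1 3); apply: runs_write; rewrite /= ?mi ?mx; try lia.
  apply: (@runs_seq _ _ _ _ 1 2); apply: runs_write; rewrite /= ?mi ?mx ?my;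
    try (case: ifP; lia); try lia.
  apply: (@runs_seq _ _ _ _ 1 1); apply: runs_write; rewrite /= ?mi ?mx ?my; try lia.
  apply: runs_write; rewrite /= ?mi ?mx ?my; try (case: ifP; lia); try lia.
  move=> p; have [Dp Sp] := Ii p.
  rewrite !big_nat_recr //= -Dp -Sp /inc nxy /= ?[ey i == ex i]eq_sym ?(negbTE nxy).
  by case: (eqVneq p (ey i)) => [->|_];
    last case: (eqVneq p (ex i)) => [->|_]; rewrite ?orbT ?mul1n ?addn0.
- by move=> m' _ H p; have [-> ->] := H p; rewrite /deg /edge_sum !big_mkord.
Qed.

(** * Stripping leaves off the partition tree *)

Implicit Types F : pred nat.

Lemma deg_eq0 F p j : deg F p = 0 -> j < M -> F j -> inc j p = false.
Proof.
move=> /eqP; rewrite sum_nat_eq0 => /forallP H jM Fj.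
by have := H (Ordinal jM); rewrite /= Fj /=; case: (inc j p).
Qed.

Lemma deg0_edge_sum F p : deg F p = 0 -> edge_sum F p = 0.
Proof. by move=> d0; apply: big1 => j Fj; rewrite (deg_eq0 d0 (ltn_ord j) Fj). Qed.

Lemma deg_rem F p j : j < M -> F j ->
  deg F p = inc j p + deg (fun x => F x && (x != j)) p /\
  edge_sum F p = inc j p * j + edge_sum (fun x => F x && (x != j)) p.
Proof. by move=> jM Fj; rewrite /deg /edge_sum !(bigD1 (Ordinal jM) Fj). Qed.

Lemma deg1_edge_sum F w : deg F w = 1 ->
  let j := edge_sum F w in
  [/\ j < M, F j, inc j w & deg (fun x => F x && (x != j)) w = 0].
Proof.
move=> d1.
have [j jM [Fj ij]] : exists2 j, j < M & F j /\ inc j w.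
  suff: ~~ [forall (i : 'I_M | F i), inc i w == 0 :> nat].
    case/forallPn=> j; rewrite negb_imply => /andP[Fj ij].
    by exists j => //; split=> //; case: (inc j w) ij.
  by rewrite -sum_nat_eq0 -/(deg F w) d1.
have [] := deg_rem w jM Fj; rewrite d1 ij => -[/esym d0] ->.
by rewrite mul1n (deg0_edge_sum d0) addn0.
Qed.

Hypothesis forest : forall F, (exists2 j, j < M & F j /\ ex j != ey j) ->
  exists p, deg F p = 1.

Section Elimination.
Implicit Types (L : seq (nat * nat * nat)) (x : nat * nat * nat).

(** A triple (w, u, j) records that the leaf w was removed, hanging from u by the
    edge j. *)
Definition joins x :=
  [/\ x.2 < M, x.1.1 != x.1.2 & x.1 = (ex x.2, ey x.2) \/ x.1 = (ey x.2, ex x.2)].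
(** A removed leaf is on no edge that is removed later.  This is all that the
    arguments about crossings use of the order of removal. *)
Definition avoids x x' := (x.1.1 != x'.1.1) && (x.1.1 != x'.1.2).
Definition edges_of L := [seq x.2 | x <- L].
Definition alive L : pred nat := [pred j | j \notin edges_of L].

Definition elimination L :=
  [/\ forall x, x \in L -> joins x, pairwise avoids L & uniq (edges_of L)].

Lemma size_elimination L : elimination L -> size L <= M.
Proof.
case=> jL _ uL; rewrite -(size_map (fun x => x.2)) -[M](size_iota 0).
apply: uniq_leq_size => // j /mapP[x /jL[xM _ _] ->].
by rewrite mem_iota.
Qed.

Definition stores_elimination L m' :=
  reg m' xLen = size L /\
  forall a, a < size L ->
    let x := nth (0, 0, 0) L a in
    [/\ arr m' aLeaf a = x.1.1, arr m' aNbr a = x.1.2 & arr m' aEdge a = x.2].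

(** The scan position xV visits all bags, while xW leaves it to follow a chain of
    leaves that appear one after the other.  The field si_seen says that xW is the
    only place where a leaf may have been missed at or below xV.  By si_v each round
    is a removal or an advance of xV, and there are at most M removals, so that
    2 * M rounds bring xV past the last bag; then si_w puts xW there too. *)
Record strip_inv L i m' : Prop := StripInv {
  si_elim : elimination L;
  si_store : stores_elimination L m';
  si_deg : forall p, arr m' aDeg p = deg (alive L) p;
  si_sum : forall p, arr m' aSum p = edge_sum (alive L) p;
  si_dead : forall x, x \in L -> deg (alive L) x.1.1 = 0;
  si_v : reg m' xV + size L = i;
  si_w : reg m' xW < M -> reg m' xV < M;
  si_wv : reg m' xW <= reg m' xV + M;
  si_seen : forall p, p <= reg m' xV -> p != reg m' xW -> deg (alive L) p != 1 }.

Lemma deg_le F p : deg F p <= M.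
Proof.
rewrite -[leqRHS]card_ord -sum1_card /deg big_mkcond; apply: leq_sum => j _.
by case: (F j) => //; case: (inc j p).
Qed.

Lemma edge_sum_le F p : edge_sum F p <= M * M.
Proof.
have : \sum_(j < M) M = M * M by rewrite sum_nat_const card_ord.
move=> <-; rewrite /edge_sum big_mkcond; apply: leq_sum => j _.
by case: (F j) => //; case: (inc j p); have := ltn_ord j; lia.
Qed.

Lemma eq_deg F F' : F =1 F' -> deg F =1 deg F'.
Proof. by move=> FF' p; apply: eq_bigl => j; rewrite FF'. Qed.

Lemma eq_edge_sum F F' : F =1 F' -> edge_sum F =1 edge_sum F'.
Proof. by move=> FF' p; apply: eq_bigl => j; rewrite FF'. Qed.

Lemma elimination_rcons L w :
  elimination L -> (forall x, x \in L -> deg (alive L) x.1.1 = 0) ->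
  deg (alive L) w = 1 ->
  let j := edge_sum (alive L) w in
  let u := ex j + ey j - w in
  let L' := rcons L (w, u, j) in
  [/\ elimination L', forall x, x \in L' -> deg (alive L') x.1.1 = 0,
      [/\ j < M, u < M & w < M],
      forall p, deg (alive L') p = if p == u then deg (alive L) u - 1
                                  else if p == w then 0 else deg (alive L) p
    & forall p, edge_sum (alive L') p =
        if p == u then edge_sum (alive L) u - j
        else if p == w then 0 else edge_sum (alive L) p].
Proof.
move=> [jL aL uL] dead d1 j u L'.
have [] := deg1_edge_sum d1; rewrite -/j => jM Fj ijw d0.
have aliveE : alive L' =1 (fun a => alive L a && (a != j)).
  by move=> a; rewrite /alive /edges_of /= map_rcons mem_rcons inE negb_or andbC.
have [xj yj] := (ex_lt jM, ey_lt jM).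
have [nxy wj] := andP ijw.
have Ew : (w, u) = (ex j, ey j) \/ (w, u) = (ey j, ex j).
  by rewrite /u; case/orP: wj => /eqP->; [left | right]; congr pair; lia.
have uM : u < M by case: Ew => -[_ ->].
have wM : w < M by case: Ew => -[-> _].
have nwu : w != u by case: Ew => -[-> ->] //; rewrite eq_sym.
have iju p : inc j p = (p == u) || (p == w).
  by rewrite /inc nxy /=; case: Ew => -[-> ->] //; rewrite orbC.
have dE p := deg_rem p jM Fj.
have d0' : deg (alive L') w = 0 by rewrite (eq_deg aliveE).
split=> //.
- split.
  + by move=> x; rewrite mem_rcons inE => /predU1P[->|/jL //]; split.
  + rewrite pairwise_rcons aL andbT; apply/allP => x xL; rewrite /avoids /=.
    by have := deg_eq0 (dead x xL) jM Fj; rewrite iju => /norP[-> ->].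
  + by rewrite /edges_of map_rcons rcons_uniq uL andbT.
- move=> x; rewrite mem_rcons inE => /predU1P[-> //|/dead dx].
  rewrite (eq_deg aliveE); have [] := dE x.1.1; rewrite dx; lia.
- move=> p; rewrite (eq_deg aliveE); case: (eqVneq p u) => [->|npu].
    by have [-> _] := dE u; rewrite iju eqxx; lia.
  case: (eqVneq p w) => [-> //|npw].
  by have [-> _] := dE p; rewrite iju (negbTE npu) (negbTE npw).
- move=> p; rewrite (eq_edge_sum aliveE); case: (eqVneq p u) => [->|npu].
    by have [_ ->] := dE u; rewrite iju eqxx mul1n; lia.
  case: (eqVneq p w) => [-> //|npw]; first by rewrite deg0_edge_sum.
  by have [_ ->] := dE p; rewrite iju (negbTE npu) (negbTE npw).
Qed.

Definition full_elimination L :=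
  elimination L /\ forall j, j < M -> ex j != ey j -> j \in edges_of L.

Definition strip_leaves : cmd :=
  (xV ::= #0 ;; xW ::= #0 ;; xLen ::= #0 ;;
   For xI (#2 * rM)
     (If (aDeg.[xW] == #1)
       (xE ::= aSum.[xW] ;;
        xU ::= aX.[xE] + aY.[xE] - xW ;;
        aLeaf`[xLen] ::= xW ;;
        aNbr`[xLen] ::= xU ;;
        aEdge`[xLen] ::= xE ;;
        xLen ::= xLen + #1 ;;
        aDeg`[xW] ::= #0 ;;
        aSum`[xW] ::= #0 ;;
        aDeg`[xU] ::= aDeg.[xU] - #1 ;;
        aSum`[xU] ::= aSum.[xU] - xE ;;
        xW ::= xU)
       (xV ::= xV + #1 ;; xW ::= xV)))%C.

Lemma strip_leaves_ok m :
  holds_input m ->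
  (forall p, arr m aDeg p = deg predT p /\ arr m aSum p = edge_sum predT p) ->
  runs B strip_leaves m (M * 28 + 5) (fun m' =>
    exists2 L, full_elimination L & stores_elimination L m').
Proof.
move=> inp DS.
have B1 := square_bound; have n_bound := n_bound.
have -> : M * 28 + 5 = 1 + (1 + (1 + (2 * M * 14 + 2))) by lia.
do 3!(apply: runs_seq; apply: runs_assign => /=; first lia).
pose I i m' := exists L, strip_inv L i m'.
apply: (@runs_for _ _ _ _ _ (2 * M) 12 I) => //; first nia.
- by move=> m' fr; case: (frame_input _ _ fr (_ : holds_input _)) => // -[_ _ /= ->].
- exists [::]; split=> //=; try by move=> p; have [] := DS p.
  by move=> p; rewrite leqn0 => /eqP->.
- move=> i m' iM fr mi [L [eL [mL sL] dL esL dead mv mw mwv seen]].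
  have [_ [_ [mx my _]]] : holds_input m' by apply: frame_input fr _.
  have sM := size_elimination eL.
  apply: runs_if => /=; rewrite dL => cond; last first.
    apply: (@runs_seq _ _ _ _ 1 10); apply: runs_assign; rewrite /=; first nia.
    apply: runs_assign; rewrite /=; first nia.
    exists L; split=> //=; try lia.
    move=> p; rewrite addn1 leq_eqVlt ltnS => /predU1P[->|pv pv1]; first by rewrite eqxx.
    case: (eqVneq p (reg m' xW)) => [->|]; last exact: seen.
    by apply/eqP => d1; case/eqP: cond; rewrite d1.
  have d1 : deg (alive L) (reg m' xW) = 1 by apply/eqP; move: cond; case: (_ == 1).
  have [] := elimination_rcons eL dead d1.
  set w := reg m' xW in d1 mw mwv seen cond *.
  set j := edge_sum _ _; set u := ex j + _ - _; set L' := rcons _ _.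
  move=> eL' dead' [jM uM wM] dL' esL'.
  have nuw : u != w.
    rewrite eq_sym; have [+ _ _] := eL'; move/(_ (w, u, j)).
    by rewrite mem_rcons inE eqxx => /(_ isT) [].
  have esLB p : edge_sum (alive L) p < B by have := edge_sum_le (alive L) p; nia.
  have dLB p : deg (alive L) p < B by have := deg_le (alive L) p; lia.
  apply: (@runs_seq _ _ _ _ 1 10); apply: runs_assign; rewrite /= ?esL; first exact: esLB.
  have [dLu esLu] := (dLB u, esLB u).
  apply: (@runs_seq _ _ _ _ 1 9); apply: runs_assign;
    rewrite /= ?esL ?mx ?my -/w -/j -/u; first lia.
  apply: (@runs_seq _ _ _ _ 1 8); apply: runs_write; rewrite /= ?mL; try lia.
  apply: (@runs_seq _ _ _ _ 1 7); apply: runs_write; rewrite /= ?mL; try lia.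
  apply: (@runs_seq _ _ _ _ 1 6); apply: runs_write; rewrite /= ?mL; try lia.
  apply: (@runs_seq _ _ _ _ 1 5); apply: runs_assign; rewrite /= ?mL ?addn1; try lia.
  apply: (@runs_seq _ _ _ _ 1 4); apply: runs_write; rewrite /= -/w; try lia.
  apply: (@runs_seq _ _ _ _ 1 3); apply: runs_write; rewrite /= -/w; try lia.
  apply: (@runs_seq _ _ _ _ 1 2); apply: runs_write; rewrite /= -/w ?dL ?(negbTE nuw); try lia.
  apply: (@runs_seq _ _ _ _ 1 1); apply: runs_write; rewrite /= -/w ?esL ?(negbTE nuw); try lia.
  apply: runs_assign; rewrite /= -/w ?esL ?(negbTE nuw); try lia.
  exists L'; split=> //=.
  - split; first by rewrite /= size_rcons.
    move=> a; rewrite size_rcons ltnS leq_eqVlt nth_rcons => /predU1P[->|aL].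
      by rewrite /= ltnn !eqxx.
    by rewrite /= aL (ltn_eqF aL); apply: sL.
  - by move=> p; rewrite dL dL'.
  - by move=> p; rewrite esL esL'.
  - by rewrite size_rcons; lia.
  - by move=> _; apply: mw.
  - lia.
  - move=> p pv pu; rewrite dL' (negbTE pu); case: (eqVneq p w) => // pw.
    exact: seen.
- move=> m' _ [L [eL stL _ _ _ mv mw _ seen]]; exists L => //; split=> // j jM nxy.
  have sM := size_elimination eL.
  apply: contraT => Fj; have [|p d1] := forest (F := alive L); first by exists j.
  have [jpM _ ijp _] := deg1_edge_sum d1.
  have pM : p < M by case/andP: ijp => _ /orP[] /eqP->; [apply: ex_lt | apply: ey_lt].
  have vM : M <= reg m' xV by lia.
  have wM : M <= reg m' xW by rewrite leqNgt; apply/negP => /mw; lia.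
  have : deg (alive L) p != 1 by apply: seen; lia.
  by rewrite d1.
Qed.

(** * Tracing the tree paths *)

(** A token that sits on a removed leaf slides to the neighbour of that leaf. *)
Definition slide x p := if p == x.1.1 then x.1.2 else p.
Definition settle L p := foldl (fun p x => slide x p) p L.

(** Here c and d are the current positions of two tokens, and x removes the leaf w
    that hangs from u.  The bags from which a token would by now have slid to w form
    a side of the tree that only the edge from w to u leaves.  Hence that edge
    separates the two starting bags exactly when one of the tokens is at w and the
    other is not; it is oriented from the side of the first token. *)
Definition cross1 x c d :=
  if c == x.1.1 then (if d == x.1.1 then [::] else [:: x])
  else if d == x.1.1 then [:: ((x.1.2, x.1.1), x.2)] else [::].

Fixpoint crossings L c d :=
  if L is x :: L' then cross1 x c d ++ crossings L' (slide x c) (slide x d) else [::].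

Lemma crossings_rcons L x c d :
  crossings (rcons L x) c d = crossings L c d ++ cross1 x (settle L c) (settle L d).
Proof. by elim: L c d => [|y L IHL] c d /=; rewrite ?cats0 // IHL catA. Qed.

Definition writes i x := [:: ((2 * i + 1) * n + x.1.1, x.2.+1); (2 * i * n + x.1.2, x.2.+1)].
Definition path_writes L i :=
  flatten [seq writes i x | x <- crossings L (bag (s i)) (bag (t i))].
Definition slot_writes L i := flatten [seq path_writes L j | j <- iota 0 i].
(** The content of an initially zero array after a list of writes: the last write
    to a cell wins. *)
Definition lookup (ws : seq (nat * nat)) a :=
  foldl (fun v w => if a == w.1 then w.2 else v) 0 ws.

Definition trace_paths : cmd :=
  For xI rK
    (xC ::= aBag.[aS.[xI]] ;; xD ::= aBag.[aT.[xI]] ;;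
     For xJ xLen
       (xW ::= aLeaf.[xJ] ;; xU ::= aNbr.[xJ] ;; xE ::= aEdge.[xJ] + #1 ;;
        If (xC == xW)
          (If (xD == xW)
             (xD ::= xU)
             (aSlot`[(#2 * xI + #1) * rN + xW] ::= xE ;;
              aSlot`[#2 * xI * rN + xU] ::= xE) ;;
           xC ::= xU)
          (If (xD == xW)
             (aSlot`[(#2 * xI + #1) * rN + xU] ::= xE ;;
              aSlot`[#2 * xI * rN + xW] ::= xE ;;
              xD ::= xU)
             Skip))).

Lemma slot_bound i p : i < k -> p < n -> (2 * i + 1) * n + p < B.
Proof. by nia. Qed.

Lemma trace_paths_ok m L :
  holds_input m -> elimination L -> stores_elimination L m ->
  (forall a, arr m aSlot a = 0) ->
  runs B trace_paths m (k * (M * 10 + 6) + 2) (fun m' =>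
    forall a, arr m' aSlot a = lookup (slot_writes L k) a).
Proof.
move=> inp eL stL sl0.
have k_bound := k_bound; have n_bound := n_bound; have sLM := size_elimination eL.
pose I i m' := forall a, arr m' aSlot a = lookup (slot_writes L i) a.
have -> : M * 10 + 6 = (1 + (1 + (M * 10 + 2))).+2 by lia.
apply: (@runs_for _ _ _ _ _ k _ I) => //; first lia.
- by move=> m' fr; case: (frame_input _ _ fr inp) => // -[].
- move=> i m' ik fr mi Ii.
  have [[mn _ _] [[mbag ms mt _] _]] : holds_input m' by apply: frame_input fr inp.
  have [sb tb] := (bag_lt (s_lt ik), bag_lt (t_lt ik)).
  apply: runs_seq; apply: runs_assign; rewrite /= mbag ?ms mi; first lia.
  apply: runs_seq; apply: runs_assign; rewrite /= mbag ?mt mi; first lia.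
  pose J a m'' := [/\ reg m'' xC = settle (take a L) (bag (s i)),
    reg m'' xD = settle (take a L) (bag (t i)) &
    forall b, arr m'' aSlot b = lookup (slot_writes L i ++
      flatten [seq writes i x | x <- crossings (take a L) (bag (s i)) (bag (t i))]) b].
  apply: (@runs_weaken _ _ _ (size L * 10 + 2) _ _ _ _ _ (fun m' => id)); last by lia.
  apply: (@runs_for _ _ _ _ _ (size L) 8 J) => //; first lia.
  + move=> m'' fr'; case: stL => <- _; case: fr' => /= -> //=; case: fr => /= -> //.
  + by rewrite /J take0; split=> //= b; rewrite cats0.
  + move=> a m'' aL fr'' ma [mc md Jm].
    have [[mn' _ _] _] : holds_input m''.
      by apply: frame_input fr'' _ => //; apply: frame_input fr inp.
    have mi' : reg m'' xI = i by case: fr'' => -> //.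
    set x := nth (0, 0, 0) L a.
    set cc := settle _ _ in mc; set dd := settle _ _ in md.
    pose K m3 := [/\ reg m3 xC = slide x cc, reg m3 xD = slide x dd &
      forall b, arr m3 aSlot b = foldl (fun v w => if b == w.1 then w.2 else v)
        (arr m'' aSlot b) (flatten [seq writes i y | y <- cross1 x cc dd])].
    apply: (@runs_weaken _ _ _ 8 _ K) => //; last first.
      move=> m3 [Kc Kd Ks]; rewrite /J (take_nth (0, 0, 0) aL) -/x.
      rewrite /settle !foldl_rcons -!/(settle _ _) -/cc -/dd; split=> // b.
      rewrite [LHS]/= Ks crossings_rcons map_cat flatten_cat catA /lookup foldl_cat.
      by rewrite -/(lookup _ _) -Jm.
    have xL : x \in L by rewrite mem_nth.
    have [jL _ _] := eL; have [xM nwu Ex] := jL x xL.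
    have [wM uM] : x.1.1 < M /\ x.1.2 < M.
      by have [] := (ex_lt xM, ey_lt xM); case: Ex => -> /=.
    have [st1 st2 st3] :
        [/\ arr m'' aLeaf a = x.1.1, arr m'' aNbr a = x.1.2 & arr m'' aEdge a = x.2].
      have [_ /(_ a aL)] := stL; have [_ A1] := fr''; have [_ A2] := fr.
      by rewrite -!A2 // -!A1.
    have sb1 := slot_bound ik (leq_trans wM leMn).
    have sb2 := slot_bound ik (leq_trans uM leMn).
    apply: (@runs_seq _ _ _ _ 1 7); apply: runs_assign; rewrite /= ma ?st1; first lia.
    apply: (@runs_seq _ _ _ _ 1 6); apply: runs_assign; rewrite /= ma ?st2; first lia.
    apply: (@runs_seq _ _ _ _ 1 5); apply: runs_assign; rewrite /= ma ?st3 ?addn1; first lia.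
    rewrite /K /cross1 /slide.
    apply: runs_if => /= cond1.
      have /eqP cw : cc == x.1.1 by rewrite -mc; exact: natb_neq0 cond1.
      apply: (@runs_seq _ _ _ _ 3 1).
      apply: runs_if => /= cond2.
        have /eqP dw : dd == x.1.1 by rewrite -md; exact: natb_neq0 cond2.
        apply: runs_assign; rewrite /=; first lia.
        apply: runs_assign; rewrite /=; first lia.
        by rewrite cw dw eqxx.
      have /negbTE dw : dd != x.1.1 by rewrite -md; exact: natb_eq0 cond2.
      apply: (@runs_seq _ _ _ _ 1 1); apply: runs_write; rewrite /= ?mn' ?mi'; try lia.
      apply: runs_write; rewrite /= ?mn' ?mi'; try lia.
      apply: runs_assign; rewrite /=; first lia.
      by rewrite dw cw eqxx.
    have /negbTE cw : cc != x.1.1 by rewrite -mc; exact: natb_eq0 cond1.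
    apply: runs_if => /= cond2.
      have /eqP dw : dd == x.1.1 by rewrite -md; exact: natb_neq0 cond2.
      apply: (@runs_seq _ _ _ _ 1 2); apply: runs_write; rewrite /= ?mn' ?mi'; try lia.
      apply: (@runs_seq _ _ _ _ 1 1); apply: runs_write; rewrite /= ?mn' ?mi'; try lia.
      apply: runs_assign; rewrite /=; first lia.
      by rewrite cw dw eqxx.
    have /negbTE dw : dd != x.1.1 by rewrite -md; exact: natb_eq0 cond2.
    by apply: runs_skip; rewrite /= cw dw.
  + move=> m'' _ [_ _ Jm] b; rewrite /= Jm take_size.
    by rewrite /slot_writes -[in RHS]addn1 iotaD map_cat flatten_cat add0n /= cats0.
Qed.

End Elimination.

(** * Candidate vertices of a slot *)

Definition compute_allowed : cmd :=
  For xI (#2 * rK * rN)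
    (aAllow`[xI] ::=
       #0 < aSlot.[xI %/ rN * rN + aBag.[xI %% rN]]
         * aDom.[xI %/ rN %/ #2 * rN + xI %% rN]
         * aBd.[(aSlot.[xI %/ rN * rN + aBag.[xI %% rN]] - #1) * rN + xI %% rN]
         * ((aTerm.[xI %% rN] == #0) + (xI %% rN == aS.[xI %/ rN %/ #2])
            + (xI %% rN == aT.[xI %/ rN %/ #2]))).

Section Allowed.
Variable slot : nat -> nat.

(** The slot and the vertex are packed into one array index a.  The last clause
    reserves a terminal for the paths that end in it, which is what internal
    disjointness asks of terminals. *)
Definition allowed a : bool :=
  let sg := a %/ n in let v := a %% n in let e := slot (sg * n + bag v) in
  [&& e != 0, dom (sg %/ 2 * n + v) != 0, bd (e.-1 * n + v) != 0 &
    [|| ~~ terminals k v, v == s (sg %/ 2) | v == t (sg %/ 2)]].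

Lemma compute_allowed_ok m :
  holds_input m -> (forall a, arr m aSlot a = slot a) ->
  (forall v, arr m aTerm v = terminals k v) ->
  runs B compute_allowed m (2 * k * n * 3 + 2) (fun m' =>
    forall a, a < 2 * k * n -> arr m' aAllow a = allowed a).
Proof.
move=> inp sl te.
have k_bound := k_bound; have n_bound := n_bound.
pose I i m' := forall a, a < i -> arr m' aAllow a = allowed a.
have knB : 2 * k * n < B by nia.
apply: (@runs_for _ _ _ _ _ (2 * k * n) 1 I) => //.
- move=> m' fr; have [[mn mk _] _] : holds_input m' by apply: frame_input fr inp.
  by rewrite /= mn mk.
- move=> i m' ik fr mi Ii.
  have [[mn mk mM] [[mbag ms mt mdom] [mx my mbd]]] : holds_input m' by apply: frame_input fr inp.
  have [_ A] := fr.
  apply: runs_write; rewrite /= ?mi; first lia.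
    by apply: leq_ltn_trans (leq_b1 _) _; lia.
  move=> a; rewrite ltnS leq_eqVlt => /predU1P[->|ai] /=; last first.
    by rewrite (ltn_eqF ai); apply: Ii.
  rewrite eqxx mn mbag ms mt mdom mbd !A //= !sl !te /allowed.
  rewrite !muln_gt0 -!lt0n subn1 -!andbA !addn_gt0 !lt0b.
  by case: (terminals _ _).
Qed.
End Allowed.

(** * Keeping few candidates *)

Definition compute_kernel : cmd :=
  For xV rN
    (xP ::= aBag.[xV] ;; xMark ::= #0 ;;
     For xI (#4 * rK * rK)
       (If (aAllow.[xI %/ (#2 * rK) * rN + xV] * aAllow.[xI %% (#2 * rK) * rN + xV]
             * (aCount.[xP * (#4 * rK * rK) + xI] < #2 * rK))
          (aCount`[xP * (#4 * rK * rK) + xI] ::=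
             aCount.[xP * (#4 * rK * rK) + xI] + #1 ;;
           xMark ::= #1)
          Skip) ;;
     If xMark
       (aKer`[xP * (#8 * rK * rK * rK + #1) + aSize.[xP]] ::= xV ;;
        aSize`[xP] ::= aSize.[xP] + #1)
       Skip).

Section Kernel.
Variable allow : pred nat.

(** A pair (sg, ta) of slots is coded by z = sg * (2 * k) + ta. *)
Definition both z v := allow (z %/ (2 * k) * n + v) && allow (z %% (2 * k) * n + v).
Definition earlier p z v := count (fun x => (bag x == p) && both z x) (iota 0 v).
Definition first_few v z := both z v && (earlier (bag v) z v < 2 * k).
(** For each pair of slots, the first 2 * k vertices of a bag that are allowed in
    both are enough: the at most 2 * k vertices of a choice cannot block all of them.
    Pairs are needed because one vertex may serve a path both on entering and on
    leaving a bag. *)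
Definition marked v := has (first_few v) (iota 0 (4 * k * k)).
Definition kernel p v := [seq x <- iota 0 v | (bag x == p) && marked x].

Lemma size_kernel p v : size (kernel p v) <= 8 * k * k * k.
Proof.
rewrite size_filter.
have : \sum_(z <- iota 0 (4 * k * k)) 2 * k = 8 * k * k * k.
  by rewrite big_const_seq count_predT size_iota iter_addn_0; clear; lia.
move=> <-.
pose Q z x := ((bag x == p) && both z x) && (earlier p z x < 2 * k).
apply: leq_trans (leq_trans (leq_count_has Q _ (iota 0 (4 * k * k))) _).
  apply: sub_count => x /andP[/eqP bx /hasP[z zk fz]]; apply/hasP; exists z => //.
  by rewrite /Q -bx eqxx.
apply: leq_sum => z _; rewrite /Q /earlier.
by rewrite (count_first (fun x => (bag x == p) && both z x)) geq_minl.
Qed.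

Lemma kernelS p v : kernel p v.+1 =
  if (bag v == p) && marked v then rcons (kernel p v) v else kernel p v.
Proof. by rewrite /kernel iotaSr filter_rcons. Qed.

Lemma earlierS p z v : earlier p z v.+1 = earlier p z v + ((bag v == p) && both z v).
Proof. by rewrite /earlier iotaSr -cats1 count_cat /= addn0. Qed.

Definition stores_kernel v m' := forall p, p < M ->
  arr m' aSize p = size (kernel p v) /\
  forall d, d <= 8 * k * k * k ->
    arr m' aKer (p * (8 * k * k * k + 1) + d) = nth 0 (kernel p v) d.

Lemma compute_kernel_ok m :
  holds_input m -> (forall a, a < 2 * k * n -> arr m aAllow a = allow a) ->
  (forall a, arr m aCount a = 0) -> (forall a, arr m aKer a = 0) ->
  (forall a, arr m aSize a = 0) ->
  runs B compute_kernel m (n * (4 * k * k * 5 + 9) + 2) (stores_kernel n).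
Proof.
move=> inp al cn0 ke0 si0.
have k_bound := k_bound; have n_bound := n_bound.
pose I v m' := (forall p z, p < M -> z < 4 * k * k ->
    arr m' aCount (p * (4 * k * k) + z) = minn (2 * k) (earlier p z v)) /\
  stores_kernel v m'.
have -> : 4 * k * k * 5 + 9 = (1 + (1 + ((4 * k * k * 5 + 2) + 3))).+2 by lia.
apply: (@runs_for _ _ _ _ _ n _ I) => //; first lia.
- by move=> m' fr; case: (frame_input _ _ fr inp) => // -[].
- split=> [p z _ _|p _] /=; first by rewrite cn0 minn0.
  by rewrite si0; split=> // d _; rewrite ke0 nth_nil.
- move=> v m' vn fr mv [Ic Ik].
  have inp' : holds_input m' by apply: frame_input fr inp.
  have [_ [[mbag _ _ _] _]] := inp'.
  have bM := bag_lt vn.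
  apply: (@runs_seq _ _ _ _ 1); apply: runs_assign; rewrite /= mbag mv; first lia.
  apply: (@runs_seq _ _ _ _ 1); apply: runs_assign; rewrite /=; first lia.
  pose J z m'' := (forall p z', p < M -> z' < 4 * k * k ->
      arr m'' aCount (p * (4 * k * k) + z') =
        minn (2 * k) (earlier p z' (if z' < z then v.+1 else v))) /\
    reg m'' xMark = has (first_few v) (iota 0 z).
  apply: runs_seq.
  apply: (@runs_for _ _ _ _ _ (4 * k * k) 3 J) => //; first exact: loop_bound.
  + move=> m'' fr'; have [[_ mk _] _] : holds_input m''.
      by apply: frame_input fr' _ => //; exact: inp'.
    by rewrite /= mk.
  + move=> z m'' zk fr' mz [Jc Jm].
    have [[mn mk _] _] : holds_input m'' by apply: frame_input fr' _ => //; exact: inp'.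
    have [mp mv'] : reg m'' xP = bag v /\ reg m'' xV = v.
      by have [R _] := fr'; rewrite !R.
    have alE a : a < 2 * k * n -> arr m'' aAllow a = allow a.
      by have [_ A'] := fr' => an; rewrite A' //= -(al a an); have [_ ->] := fr.
    have k0 : 0 < k by lia.
    have q1 : z %/ (2 * k) < 2 * k by rewrite ltn_divLR; nia.
    have q2 : z %% (2 * k) < 2 * k by rewrite ltn_pmod // muln_gt0.
    have alz : arr m'' aAllow (z %/ (2 * k) * n + v) * arr m'' aAllow (z %% (2 * k) * n + v)
               = both z v.
      by rewrite !alE /both ?mulnb //; apply: pair_lt.
    have cnz : arr m'' aCount (bag v * (4 * k * k) + z) = minn (2 * k) (earlier (bag v) z v).
      by rewrite Jc // ltnn.
    have ffE : both z v * (minn (2 * k) (earlier (bag v) z v) < 2 * k) = first_few v z.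
      by rewrite mulnb /first_few gtn_min ltnn.
    have az : bag v * (4 * k * k) + z < B.
      by apply: count_bound => //; apply: leq_trans leMn.
    clear B_gt; apply: runs_if; rewrite /= mz mn mk mv' mp alz cnz ffE => cond.
      have {}cond := natb_neq0 cond.
      apply: (@runs_seq _ _ _ _ 1 1); apply: runs_write;
        rewrite /= ?mz ?mn ?mk ?mv' ?mp ?cnz; try lia.
      apply: runs_assign; rewrite /= ?mz ?mn ?mk ?mv' ?mp ?cnz; first lia.
      split; last by rewrite iotaSr has_rcons cond.
      move=> p z' pM z'k /=; rewrite pair_inj // ltnS.
      have [bz lt] := andP cond.
      case: (eqVneq p (bag v)) => [->|pv]; case: (eqVneq z' z) => [->|zz'] /=.
      * by rewrite leqnn earlierS eqxx bz minn_succ.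
      * by rewrite Jc // [z' <= z]leq_eqVlt (negbTE zz').
      * by rewrite leqnn Jc // ltnn earlierS [bag v == p]eq_sym (negbTE pv) addn0.
      * by rewrite Jc // [z' <= z]leq_eqVlt (negbTE zz').
    have {}cond := negbTE (natb_eq0 cond).
    apply: runs_skip; split; last by rewrite iotaSr has_rcons cond /= Jm.
    move=> p z' pM z'k /=; rewrite Jc // ltnS [z' <= z]leq_eqVlt.
    case: (eqVneq z' z) => [->|//] /=; rewrite ltnn {zk alz az cnz ffE} earlierS.
    case: (eqVneq (bag v) p) => [bv|//] /=; last by rewrite addn0.
    move: cond; rewrite /first_few -bv; case: (both z v) => /=; rewrite ?addn0 // addn1.
    move/negbT; rewrite -leqNgt => le.
    by rewrite (minn_idPl le) (minn_idPl (leqW le)).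
  + move=> m'' fr' [Jc Jm].
    have [[mn mk _] _] : holds_input m'' by apply: frame_input fr' _ => //; exact: inp'.
    have [mp mv'] : reg m'' xP = bag v /\ reg m'' xV = v.
      by have [R _] := fr'; rewrite !R.
    have Ik'' : stores_kernel v m'' by move=> p pM; have [_ A] := fr'; rewrite !A //; exact: Ik.
    have Jc' p z : p < M -> z < 4 * k * k ->
        arr m'' aCount (p * (4 * k * k) + z) = minn (2 * k) (earlier p z v.+1).
      by move=> pM zk; rewrite Jc // zk.
    have [sv kv] := Ik'' _ bM.
    have sk : size (kernel (bag v) v) < 8 * k * k * k + 1 by rewrite addn1 ltnS size_kernel.
    have ak : bag v * (8 * k * k * k + 1) + size (kernel (bag v) v) < B.
      by apply: kernel_bound => //; apply: leq_trans leMn.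
    have kB := base_bound.
    apply: runs_if; rewrite /= Jm => cond.
      have {}cond : marked v := natb_neq0 cond.
      apply: (@runs_seq _ _ _ _ 1 1); apply: runs_write; rewrite /= ?mn ?mk ?mv' ?mp ?sv; try lia.
      apply: runs_write; rewrite /= ?mn ?mk ?mv' ?mp ?sv; try lia.
      split=> [p z pM zk|p pM] /=; first exact: Jc'.
      have [sp kp] := Ik'' _ pM.
      rewrite kernelS cond andbT [bag v == p]eq_sym; case: eqVneq => [->|pv].
        rewrite size_rcons addn1; split=> // d dk.
        rewrite pair_inj ?eqxx /=; [|lia|lia].
        rewrite nth_rcons; case: (ltngtP d (size _)) => dk' //; rewrite kv //.
        by rewrite nth_default // ltnW.
      split=> // d dk; rewrite pair_inj ?(negbTE pv) /=; [exact: kp|lia|lia].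
    have {}cond := negbTE (natb_eq0 cond).
    apply: runs_skip; split=> [p z pM zk|p pM] /=; first exact: Jc'.
    by rewrite kernelS /marked cond andbF; apply: Ik''.
- by move=> m' _ [].
Qed.
End Kernel.

(** * Searching the bags *)

Definition check_terminals : cmd :=
  xRes ::= #1 ;;
  For xI rK
    (xRes ::= #0 < xRes * aDom.[xI * rN + aS.[xI]] * aDom.[xI * rN + aT.[xI]]).

Definition terminals_in_domains :=
  all (fun i => (dom (i * n + s i) != 0) && (dom (i * n + t i) != 0)) (iota 0 k).

Lemma check_terminals_ok m :
  holds_input m ->
  runs B check_terminals m (k * 3 + 3) (fun m' => reg m' xRes = terminals_in_domains).
Proof.
move=> inp; have k_bound := k_bound; have n_bound := n_bound.
have -> : k * 3 + 3 = 1 + (k * 3 + 2) by lia.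
apply: runs_seq; apply: runs_assign; rewrite /=; first lia.
pose I i m' := reg m' xRes =
  all (fun i => (dom (i * n + s i) != 0) && (dom (i * n + t i) != 0)) (iota 0 i).
apply: (@runs_for _ _ _ _ _ k 1 I) => //; first lia.
- by move=> m' fr; case: (frame_input _ _ fr (_ : holds_input _)) => // -[].
- move=> i m' ik fr mi Ii.
  have [[mn mk mM] [[mbag ms mt mdom] [mx my mbd]]] : holds_input m' by apply: frame_input fr _.
  apply: runs_assign; rewrite /= mi mn ms mt mdom Ii.
    by apply: leq_ltn_trans (leq_b1 _) _; lia.
  by rewrite /I iotaSr all_rcons /= !muln_gt0 lt0b -!lt0n;
     case: (all _ _); rewrite ?andbF ?andbT /=.
Qed.

Section Search.
Variables (slot : nat -> nat) (allow term : pred nat) (ker : nat -> seq nat).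
Hypothesis ker_lt : forall p v, v \in ker p -> v < n.
Local Notation W := (8 * k * k * k + 1).

(** A choice d is given by positions in the kernel, possibly past its end.  The
    first disjunct refuses such a position or a vertex that is not allowed; the
    second one refuses a vertex shared by two paths unless it is a terminal, which
    then ends both. *)
Definition clash p (d : nat -> nat) z :=
  let sg := z %/ (2 * k) in let ta := z %% (2 * k) in
  let a := nth 0 (ker p) (d sg) in let b := nth 0 (ker p) (d ta) in
  (slot (sg * n + p) != 0) &&
  (~~ ((d sg < size (ker p)) && allow (sg * n + a))
   || [&& slot (ta * n + p) != 0, sg %/ 2 != ta %/ 2, a == b & ~~ term a]).

Definition good_choice p d := ~~ has (clash p d) (iota 0 (4 * k * k)).

Definition search_input m := holds_input m /\ [/\ forall a, arr m aSlot a = slot a,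
  forall a, a < 2 * k * n -> arr m aAllow a = allow a,
  forall v, arr m aTerm v = term v &
  forall p, p < M -> arr m aSize p = size (ker p) /\
    forall d, d <= 8 * k * k * k -> arr m aKer (p * W + d) = nth 0 (ker p) d].

Lemma frame_search c m m' :
  [&& rN \notin wreg c, rK \notin wreg c & rM \notin wreg c] ->
  all (fun a => a \notin warr c) [:: aBag; aS; aT; aDom; aX; aY; aBd] ->
  all (fun a => a \notin warr c) [:: aSlot; aAllow; aTerm; aSize; aKer] ->
  frame c m m' -> search_input m -> search_input m'.
Proof.
move=> r a /= /and5P[a1 a2 a3 a4 /andP[a5 _]] fr [inp H].
split; first exact: frame_input fr inp.
by case: fr => _ A; rewrite !A.
Qed.

Notation chosen sg := (aKer.[xP * (#8 * rK * rK * rK + #1) + aDigit.[sg]])%X.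

Definition conflict : expr :=
  aSlot.[xI %/ (#2 * rK) * rN + xP]
  * ((#1 - (aDigit.[xI %/ (#2 * rK)] < aSize.[xP])
           * aAllow.[xI %/ (#2 * rK) * rN + chosen (xI %/ (#2 * rK))])
     + (#0 < aSlot.[xI %% (#2 * rK) * rN + xP])
       * (#1 - (xI %/ (#2 * rK) %/ #2 == xI %% (#2 * rK) %/ #2))
       * (chosen (xI %/ (#2 * rK)) == chosen (xI %% (#2 * rK)))
       * (aTerm.[chosen (xI %/ (#2 * rK))] == #0)).

Definition test_choice : cmd :=
  xOk ::= #1 ;;
  For xI (#4 * rK * rK) (If conflict (xOk ::= #0) Skip) ;;
  If xOk (xFound ::= #1) Skip.

Lemma test_choice_ok m p d (f : bool) : search_input m -> p < M -> reg m xP = p ->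
  (forall sg, sg < 2 * k -> arr m aDigit sg = d sg /\ d sg <= 8 * k * k * k) ->
  reg m xFound = f ->
  runs B test_choice m (4 * k * k * 4 + 5) (fun m' => reg m' xFound = f || good_choice p d).
Proof.
move=> inp pM mp dig mf.
have -> : 4 * k * k * 4 + 5 = 1 + ((4 * k * k * 4 + 2) + 2) by lia.
have k_bound := k_bound; have n_bound := n_bound.
apply: runs_seq; apply: runs_assign; rewrite /=; first lia.
pose I z m' := reg m' xOk = ~~ has (clash p d) (iota 0 z).
apply: runs_seq; apply: (@runs_for _ _ _ _ _ (4 * k * k) 2 I) => //; first exact: loop_bound.
- move=> m' fr; have [[[mn mk _] _] _] : search_input m' by apply: frame_search fr inp.
  by rewrite /= mk.
- move=> z m' zk fr mz Iz.
  have inp' : search_input m' by apply: frame_search fr inp.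
  have [[[mn mk _] _] [msl mal mte mke]] := inp'.
  have [ms mk'] := mke p pM.
  have mp' : reg m' xP = p by have [R _] := fr; rewrite R.
  have dig' sg : sg < 2 * k -> arr m' aDigit sg = d sg by have [_ A] := fr; rewrite A //= => /dig[].
  have k0 : 0 < k by lia.
  have q1 : z %/ (2 * k) < 2 * k by rewrite ltn_divLR; nia.
  have q2 : z %% (2 * k) < 2 * k by rewrite ltn_pmod // muln_gt0.
  have [d1 d1b] := dig _ q1; have [d2 d2b] := dig _ q2.
  have nth_lt e : nth 0 (ker p) e < n.
    case: (ltnP e (size (ker p))) => [|le]; last by rewrite nth_default //; lia.
    by move/(mem_nth 0)/ker_lt.
  have E : (eval m' conflict != 0) = clash p d z.
    rewrite /= mz mn mk mp' !dig' // !mk' // !msl mal ?mte ?ms; last by apply: pair_lt.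
    rewrite /clash muln_eq0 negb_or; congr (_ && _).
    rewrite lt0n; set a := nth _ _ _; set b := nth _ _ _.
    by case: (_ < size _); case: (allow _); case: (slot _ != 0);
       case: (_ %/ 2 == _); case: (a == b); case: (term _).
  apply: runs_if => cond.
    apply: runs_assign; rewrite /=; first lia.
    by rewrite /I iotaSr has_rcons -E cond.
  by apply: runs_skip; rewrite /I iotaSr has_rcons -E cond; exact: Iz.
- move=> m' fr Im; have mf' : reg m' xFound = f by have [R _] := fr; rewrite R.
  apply: runs_if; rewrite /= Im => cond.
    apply: runs_assign; rewrite /=; first lia.
    by rewrite /good_choice (natb_neq0 cond) orbT.
  by apply: runs_skip; rewrite mf' /good_choice (negbTE (natb_eq0 cond)) orbF.
Qed.

Definition next_choice : cmd :=
  xCarry ::= #1 ;;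
  For xI (#2 * rK)
    (aDigit`[xI] ::= (aDigit.[xI] + xCarry) %% (#8 * rK * rK * rK + #1) ;;
     xCarry ::= xCarry * (aDigit.[xI] == #0)) ;;
  xCarry ::= #1 - xCarry.

(** The choices are counted by an odometer with 2 * k positions in base W, because
    their number W ^ (2 * k) does not fit in a machine word. *)
Lemma next_choice_ok m x : holds_input m -> x < W ^ (2 * k) ->
  (forall sg, sg < 2 * k -> arr m aDigit sg = digit W x sg) ->
  runs B next_choice m (2 * k * 4 + 4) (fun m' =>
    (forall sg, sg < 2 * k -> arr m' aDigit sg = digit W x.+1 sg) /\
    reg m' xCarry = (x.+1 < W ^ (2 * k))).
Proof.
move=> inp xW dig.
have -> : 2 * k * 4 + 4 = 1 + ((2 * k * 4 + 2) + 1) by lia.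
have k_bound := k_bound; have n_bound := n_bound; have WB := base_bound; clear B_gt.
have W0 : 0 < W by rewrite addn1.
apply: runs_seq; apply: runs_assign; rewrite /=; first lia.
pose I i m' := (forall sg, sg < 2 * k ->
   arr m' aDigit sg = digit W (if sg < i then x.+1 else x) sg) /\
   reg m' xCarry = (W ^ i %| x.+1).
apply: runs_seq; apply: (@runs_for _ _ _ _ _ (2 * k) 2 I) => //; first lia.
- move=> m' fr; have [[mn mk _] _] : holds_input m' by apply: frame_input fr inp.
  by rewrite /= mk.
- by split=> //=; rewrite expn0 dvd1n.
- move=> i m' ik fr mi [Id Ic].
  have [[mn mk _] _] : holds_input m' by apply: frame_input fr inp.
  have E : (arr m' aDigit i + reg m' xCarry) %% W = digit W x.+1 i.
    by rewrite Id // ltnn Ic digitS.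
  have dB : digit W x.+1 i < W by rewrite /digit ltn_mod.
  apply: (@runs_seq _ _ _ _ 1 1); apply: runs_write; rewrite /= ?mi ?mk ?E; try lia.
  apply: runs_assign; rewrite /= ?mi ?mk eqxx Ic.
    by rewrite mulnb; apply: leq_ltn_trans (leq_b1 _) _; lia.
  split=> [sg sk|] /=; last by rewrite carryS // mulnb.
  rewrite ltnS leq_eqVlt; case: eqVneq => [->|_] //=; exact: Id.
- move=> m' fr [Id Ic]; apply: runs_assign; rewrite /= Ic; first lia.
  split=> [sg sk|] /=; first by rewrite Id // sk.
  have -> : (W ^ (2 * k) %| x.+1) = (x.+1 == W ^ (2 * k)).
    apply/idP/eqP => [/dvdn_leq le|->] //; apply/eqP; rewrite eqn_leq xW.
    exact: le.
  by rewrite [x.+1 < _]ltn_neqAle xW andbT; case: (_ == _).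
Qed.

Definition solvable_bag p := has (fun x => good_choice p (digit W x)) (iota 0 (W ^ (2 * k))).

Definition search_bags : cmd :=
  For xP rM
    (xFound ::= #0 ;;
     For xI (#2 * rK) (aDigit`[xI] ::= #0) ;;
     xCarry ::= #1 ;;
     While xCarry (test_choice ;; next_choice) ;;
     xRes ::= xRes * xFound).

Lemma search_bags_ok m (f : bool) : search_input m -> reg m xRes = f ->
  runs B search_bags m
    (M * (2 * k * 3 + 8 + W ^ (2 * k) * (4 * k * k * 4 + 2 * k * 4 + 10)) + 2)
    (fun m' => reg m' xRes = f && all solvable_bag (iota 0 M)).
Proof.
move=> inp mf.
set N := W ^ (2 * k).
have -> : 2 * k * 3 + 8 + N * (4 * k * k * 4 + 2 * k * 4 + 10) =
  (1 + ((2 * k * 3 + 2) + (1 +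
    ((N * ((4 * k * k * 4 + 5) + (2 * k * 4 + 4)).+1 + 1) + 1)))).+2.
  by move: (4 * k * k * 4) (2 * k * 4) => u v; rewrite -[RHS]addn2; lia.
have k_bound := k_bound; have n_bound := n_bound; have WB := base_bound.
have W0 : 0 < W by rewrite addn1.
pose I i m' := reg m' xRes = f && all solvable_bag (iota 0 i).
apply: (@runs_for _ _ _ _ _ M _ I) => //; first lia.
- by move=> m' fr; have [[[_ _ mM] _] _] : search_input m' by apply: frame_search fr inp.
- by rewrite /I /= andbT.
- move=> p m' pM fr mp Ip.
  have inp' : search_input m' by apply: frame_search fr inp.
  apply: runs_seq; apply: runs_assign; rewrite /=; first lia.
  pose J i m1 := forall sg, sg < i -> arr m1 aDigit sg = 0.
  apply: runs_seq; apply: (@runs_for _ _ _ _ _ (2 * k) 1 J) => //; first lia.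
  + move=> m1 fr1; have [[[_ mk _] _] _] : search_input m1 by apply: frame_search fr1 inp'.
    by rewrite /= mk.
  + move=> i m1 ik fr1 mi Ji; apply: runs_write; rewrite /= ?mi; try lia.
    move=> sg; rewrite ltnS leq_eqVlt /=; case: eqVneq => // _; exact: Ji.
  move=> m1 fr1 J0.
  have inp1 : search_input m1 by apply: frame_search fr1 inp'.
  have [mp1 mf1 mr1] : [/\ reg m1 xP = p, reg m1 xFound = 0 & reg m1 xRes = reg m' xRes].
    by have [R _] := fr1; rewrite !R.
  apply: runs_seq; apply: runs_assign; rewrite /=; first lia.
  pose K x m2 := [/\ search_input m2, reg m2 xP = p, reg m2 xRes = reg m' xRes,
    reg m2 xFound = has (fun x => good_choice p (digit W x)) (iota 0 x) &
    (forall sg, sg < 2 * k -> arr m2 aDigit sg = digit W x sg) /\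
    reg m2 xCarry = (x < N)].
  apply: runs_seq.
  apply: (@runs_while _ _ _ _ _ _ K).
  + split=> //=; split=> [sg sk|]; first by rewrite J0 // /digit div0n mod0n.
    by rewrite expn_gt0 W0.
  + move=> x m2 xN [inp2 mp2 mr2 mf2 [dig2 mc2]]; split; first by rewrite /= mc2 xN.
    apply: runs_seq; apply: runs_frame.
    apply: (@runs_weaken _ _ _ (4 * k * k * 4 + 5) _ _ _ (test_choice_ok inp2 pM mp2 _ mf2)) => //.
      move=> sg sk; rewrite dig2 //; split=> //.
      by rewrite -ltnS -[(_ * k).+1]addn1 ltn_mod.
    move=> m3 mf3 fr3.
    have inp3 : search_input m3 by apply: frame_search fr3 inp2.
    apply: runs_frame.
    apply: (@runs_weaken _ _ _ (2 * k * 4 + 4) _ _ _ (next_choice_ok (proj1 inp3) xN _)) => //.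
      by move=> sg sk; have [_ A] := fr3; rewrite A // dig2.
    move=> m4 [dig4 mc4] fr4; split=> //.
    * by apply: frame_search fr4 inp3.
    * by have [R _] := fr4; rewrite R //; have [R' _] := fr3; rewrite R'.
    * by have [R _] := fr4; rewrite R //; have [R' _] := fr3; rewrite R'.
    * by have [R _] := fr4; rewrite R // mf3 iotaSr has_rcons orbC.
  + move=> m2 [inp2 mp2 mr2 mf2 [dig2 mc2]]; split; first by rewrite /= mc2 ltnn.
    apply: runs_assign; rewrite /= mr2 mf2 Ip mulnb.
      by apply: leq_ltn_trans (leq_b1 _) _; lia.
    by rewrite /I iotaSr all_rcons /= -andbA [_ && solvable_bag _]andbC andbA.
Qed.

End Search.

(** * The whole program *)

Definition algorithm : cmd :=
  mark_terminals ;; count_edges ;; strip_leaves ;; trace_paths ;;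
  compute_allowed ;; compute_kernel ;; check_terminals ;; search_bags ;; rN ::= xRes.

Definition answer L :=
  let slot := lookup (slot_writes L k) in
  let ker p := kernel (allowed slot) p n in
  terminals_in_domains &&
  all (solvable_bag slot (allowed slot) (terminals k) ker) (iota 0 M).

Definition running_time :=
  (k * 4 + 2) + ((M * 7 + 2) + ((M * 28 + 5) + ((k * (M * 10 + 6) + 2) +
  ((2 * k * n * 3 + 2) + ((n * (4 * k * k * 5 + 9) + 2) + ((k * 3 + 3) +
  ((M * (2 * k * 3 + 8 + (8 * k * k * k + 1) ^ (2 * k)
      * (4 * k * k * 4 + 2 * k * 4 + 10)) + 2) + 1))))))).

Ltac stage := apply: runs_seq; apply: runs_frame;
  eapply runs_weaken; [ | exact: leqnn | ].

Lemma algorithm_ok m : holds_input m -> (forall r a, aTerm <= r -> arr m r a = 0) ->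
  runs B algorithm m running_time (fun m' =>
    exists2 L, full_elimination L & reg m' rN = answer L).
Proof.
move=> inp fresh; rewrite /running_time.
stage; first by apply: (mark_terminals_ok inp) => v; apply: fresh.
move=> m1 te1 fr1; have inp1 : holds_input m1 by apply: frame_input fr1 inp.
stage; first by apply: (count_edges_ok inp1) => p; rewrite (proj2 fr1) // fresh.
move=> m2 de2 fr2; have inp2 : holds_input m2 by apply: frame_input fr2 inp1.
stage; first exact: (strip_leaves_ok inp2 de2).
move=> m3 [L full_L st3] fr3; have inp3 : holds_input m3 by apply: frame_input fr3 inp2.
stage.
  apply: (trace_paths_ok inp3 (proj1 full_L) st3) => a.
  by rewrite (proj2 fr3) // (proj2 fr2) // (proj2 fr1) // fresh.
move=> m4 sl4 fr4; have inp4 : holds_input m4 by apply: frame_input fr4 inp3.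
set slot := lookup _ in sl4.
have te4 v : arr m4 aTerm v = terminals k v.
  by rewrite (proj2 fr4) // (proj2 fr3) // (proj2 fr2) // te1.
have fresh4 r a : r \in [:: aCount; aKer; aSize] -> arr m4 r a = 0.
  by rewrite !inE => /or3P[] /eqP->;
     rewrite (proj2 fr4) // (proj2 fr3) // (proj2 fr2) // (proj2 fr1) // fresh.
stage; first exact: (compute_allowed_ok inp4 sl4 te4).
move=> m5 al5 fr5; have inp5 : holds_input m5 by apply: frame_input fr5 inp4.
stage.
  by apply: (compute_kernel_ok inp5 al5) => a; rewrite (proj2 fr5) // fresh4.
move=> m6 ke6 fr6; have inp6 : holds_input m6 by apply: frame_input fr6 inp5.
stage; first exact: (check_terminals_ok inp6).
move=> m7 re7 fr7; have inp7 : holds_input m7 by apply: frame_input fr7 inp6.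
pose ker p := kernel (allowed slot) p n.
have ser7 : search_input slot (allowed slot) (terminals k) ker m7.
  split=> //; split.
  - by move=> a; rewrite (proj2 fr7) // (proj2 fr6) // (proj2 fr5) // sl4.
  - by move=> a an; rewrite (proj2 fr7) // (proj2 fr6) // al5.
  - by move=> v; rewrite (proj2 fr7) // (proj2 fr6) // (proj2 fr5) // te4.
  - by move=> p pM; rewrite !(proj2 fr7) //; apply: ke6.
have ker_lt p v : v \in ker p -> v < n by rewrite mem_filter mem_iota => /andP[].
stage; first exact: (search_bags_ok ker_lt ser7 re7).
move=> m8 re8 _; apply: runs_assign; rewrite /= re8.
  by apply: leq_ltn_trans (leq_b1 _) _; have := n_bound; lia.
by exists L.
Qed.

End Machine.

(** * Exchanging choices for kernel vertices *)

Lemma digits_onto b N (d : nat -> nat) : 0 < b -> (forall i, i < N -> d i < b) ->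
  exists2 x, x < b ^ N & forall i, i < N -> digit b x i = d i.
Proof.
move=> b0; elim: N d => [|N IHN] d db; first by exists 0.
have [|x xN dx] := IHN (fun i => d i.+1); first by move=> i iN; apply: db.
have d0 := db 0 isT; exists (x * b + d 0); first by rewrite expnSr; apply: pair_lt.
case=> [|i] iN; first by rewrite /digit divn1 modnMDl modn_small.
by rewrite -dx // /digit expnS divnMA divnMDl // (divn_small d0) addn0.
Qed.

Lemma ltn_count (T : eqType) (P Q : pred T) xs x :
  subpred P Q -> x \in xs -> Q x -> ~~ P x -> count P xs < count Q xs.
Proof.
move=> PQ xxs Qx nPx; elim: xs xxs => //= y xs IH; rewrite inE => /predU1P[<-|/IH lt].
  by rewrite Qx (negbTE nPx) add0n add1n ltnS sub_count.
have PQy : P y <= Q y by case: (P y) (PQ y) => // /(_ isT) ->.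
by rewrite -addnS leq_add.
Qed.

Section Exchange.
Variables (n k M : nat) (bag slot : nat -> nat) (allow term : pred nat) (p : nat).
Local Notation ker := (kernel n k bag allow p n).

(** This speaks of the bag p alone, so that the bags can be searched one by one. *)
Definition feasible (a : nat -> nat) := forall sg, sg < 2 * k -> slot (sg * n + p) != 0 ->
  [/\ a sg < n, bag (a sg) = p, allow (sg * n + a sg) &
    forall ta, ta < 2 * k -> slot (ta * n + p) != 0 -> sg %/ 2 != ta %/ 2 ->
      a sg = a ta -> term (a sg)].

Lemma mem_kernel v : (v \in ker) = [&& bag v == p, marked n k bag allow v & v < n].
Proof. by rewrite mem_filter mem_iota add0n -andbA. Qed.

Lemma both_pair sg ta v : sg < 2 * k -> ta < 2 * k ->
  both n k allow (sg * (2 * k) + ta) v = allow (sg * n + v) && allow (ta * n + v).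
Proof.
move=> sk tk; have k0 : 0 < 2 * k by lia.
by rewrite /both divnMDl // (divn_small tk) addn0 modnMDl modn_small.
Qed.

Lemma pair_code_lt sg ta : sg < 2 * k -> ta < 2 * k -> sg * (2 * k) + ta < 4 * k * k.
Proof. by move=> sk tk; have := pair_lt sk tk; nia. Qed.

(** If a vertex was refused by the kernel, then 2 * k vertices that are allowed in
    the same two slots came before it.  The choice a uses at most 2 * k vertices, one
    of which is outside the kernel, so one of the candidates is free. *)
Lemma unused_candidate a sg ta : feasible a -> sg < 2 * k -> ta < 2 * k ->
  a sg < n -> bag (a sg) = p -> a sg \notin ker ->
  allow (sg * n + a sg) -> allow (ta * n + a sg) ->
  exists v, [/\ v \in ker, forall i, i < 2 * k -> a i != v,
    allow (sg * n + v) & allow (ta * n + v)].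
Proof.
move=> fa sk tk an ba aker al1 al2.
set v := a sg in an ba aker al1 al2.
set z := sg * (2 * k) + ta; have zk := pair_code_lt sk tk.
have bv : both n k allow z v by rewrite both_pair // al1.
set P := fun x => (bag x == p) && both n k allow z x.
have many : 2 * k <= count P (iota 0 v).
  move: aker; rewrite mem_kernel ba eqxx an andbT /= /marked => /hasPn/(_ z).
  by rewrite mem_iota add0n => /(_ zk); rewrite /first_few bv ba /= -leqNgt.
pose l := [seq x <- iota 0 v | P x && (count P (iota 0 x) < 2 * k)].
have size_l : size l = 2 * k by rewrite size_filter count_first; lia.
have lker x : x \in l -> x \in ker /\ P x.
  rewrite mem_filter mem_iota add0n => /andP[/andP[Px cx] /= xv]; split=> //.
  have [bx Bx] := andP Px; rewrite mem_kernel bx /=.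
  apply/andP; split; last exact: ltn_trans xv an.
  apply/hasP; exists z; first by rewrite mem_iota.
  by rewrite /first_few Bx (eqP bx).
pose used := [seq a i | i <- iota 0 (2 * k)].
have [sub|] := boolP (all [in used] l).
  have : size (v :: l) <= size used.
    apply: uniq_leq_size.
      rewrite /= filter_uniq ?iota_uniq // andbT mem_filter mem_iota.
      by rewrite add0n ltnn !andbF.
    move=> x; rewrite inE => /predU1P[->|]; last exact: (allP sub).
    by apply/mapP; exists sg => //; rewrite mem_iota.
  by rewrite /= size_l size_map size_iota ltnn.
case/allPn=> x xl xused; have [xk Px] := lker x xl; exists x.
have [_] := andP Px; rewrite both_pair // => /andP[? ?]; split=> // i ik.
by apply: contraNneq xused => <-; apply/mapP; exists i => //; rewrite mem_iota.
Qed.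

Definition outside a sg := (slot (sg * n + p) != 0) && (a sg \notin ker).

(** The two slots of a path may hold the same vertex, and then both must be
    refilled together: ta is the slot that shares the vertex of sg, or sg itself if
    there is none. *)
Lemma exchange_step a sg : feasible a -> sg < 2 * k -> outside a sg ->
  exists2 a', feasible a' &
    count (outside a') (iota 0 (2 * k)) < count (outside a) (iota 0 (2 * k)).
Proof.
move=> fa sk /andP[act aker].
have [an ba al _] := fa sg sk act.
pose twin ta := [&& slot (ta * n + p) != 0, ta %/ 2 == sg %/ 2 & a ta == a sg].
have [ta [tk tw twP]] : exists ta, [/\ ta < 2 * k, twin ta &
    forall i, twin i -> i < 2 * k -> i = sg \/ i = ta].
  have [/hasP[ta]|/hasPn no] :=
      boolP (has (fun ta => twin ta && (ta != sg)) (iota 0 (2 * k))).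
    rewrite mem_iota add0n => tk /andP[tw nts]; exists ta; split=> // i /and3P[_ /eqP h _] _.
    by have [_ /eqP h' _] := and3P tw; lia.
  exists sg; split=> // [|i tw ik]; first by rewrite /twin act !eqxx.
  by left; apply/eqP; have := no i; rewrite mem_iota add0n tw => /(_ ik); rewrite negbK.
have [tact th /eqP tv] := and3P tw.
have [_ _ tal _] := fa ta tk tact; rewrite tv in tal.
have [v [vker vnew val1 val2]] := unused_candidate fa sk tk an ba aker al tal.
have [/eqP bv _ vn] := and3P (etrans (esym (mem_kernel v)) vker).
pose a' i := if (i %/ 2 == sg %/ 2) && (a i == a sg) then v else a i.
exists a'.
  move=> i ik iact; have [ain bai ali cli] := fa i ik iact.
  rewrite {1 2 3}/a'; case: ifPn => [/andP[hi vi]|ni].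
    have twi : twin i by rewrite /twin iact hi vi.
    split=> // [|j jk jact hij]; first by case: (twP i twi ik) => ->.
    rewrite /a' hi vi /=; case: ifP => [/andP[hj _]|_ vj].
      by rewrite (eqP hi) (eqP hj) eqxx in hij.
    by have := vnew j jk; rewrite vj eqxx.
  split=> // j jk jact hij; rewrite /a' (negbTE ni); case: ifP => [_ vi|_ vij].
    by have := vnew i ik; rewrite vi eqxx.
  exact: cli vij.
apply: (@ltn_count _ _ _ _ sg).
- move=> i; rewrite /outside /a' => /andP[-> /=].
  by case: ifP => // _; rewrite vker.
- by rewrite mem_iota.
- by rewrite /outside act.
- by rewrite /outside /a' !eqxx vker andbF.
Qed.

Lemma exchange a : feasible a -> exists2 a', feasible a' &
  forall sg, sg < 2 * k -> slot (sg * n + p) != 0 -> a' sg \in ker.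
Proof.
have [c] := ubnP (count (outside a) (iota 0 (2 * k))).
elim: c a => // c IHc a; rewrite ltnS => lec fa.
have [/hasP[sg]|/hasPn no] := boolP (has (outside a) (iota 0 (2 * k))).
  rewrite mem_iota add0n => sk /(exchange_step fa sk)[a' fa' lt].
  by apply: (IHc a') => //; apply: leq_trans lt lec.
exists a => // sg sk act; have := no sg; rewrite mem_iota => /(_ sk).
by rewrite /outside act negbK.
Qed.

Lemma solvable_bagP :
  reflect (exists a, feasible a)
    (solvable_bag n k slot allow term (fun p => kernel n k bag allow p n) p).
Proof.
set W := 8 * k * k * k + 1; apply: (iffP hasP) => [[x _ good]|[a0 /exchange[a fa aker]]].
  exists (fun sg => nth 0 ker (digit W x sg)) => sg sk act.
  have clashF ta : ta < 2 * k -> clash n k slot allow term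
      (fun p => kernel n k bag allow p n) p (digit W x) (sg * (2 * k) + ta) = false.
    move=> tk; apply/negbTE; apply: (hasPn good); rewrite mem_iota add0n.
    exact: pair_code_lt.
  have k0 : 0 < 2 * k by lia.
  have ctP ta : ta < 2 * k -> [/\ digit W x sg < size ker,
      allow (sg * n + nth 0 ker (digit W x sg)) &
      slot (ta * n + p) != 0 -> sg %/ 2 != ta %/ 2 ->
      nth 0 ker (digit W x sg) = nth 0 ker (digit W x ta) ->
      term (nth 0 ker (digit W x sg))].
    move=> tk; have := clashF ta tk.
    rewrite /clash divnMDl // (divn_small tk) addn0 modnMDl modn_small // act /=.
    move/norP=> [/negPn/andP[-> ->] /and4P nc]; split=> // tact h eqv.
    by apply/negPn/negP => nt; apply: nc; split=> //; apply/eqP.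
  have [dlt al _] := ctP sg sk.
  have := mem_nth 0 dlt; rewrite mem_kernel => /and3P[/eqP bv _ vn].
  by split=> // ta tk tact h eqv; have [_ _] := ctP ta tk; apply.
pose d sg := if slot (sg * n + p) != 0 then index (a sg) ker else 0.
have [||x xW dx] := @digits_onto W (2 * k) d.
- by rewrite /W addn1.
- move=> sg sk; rewrite /d; case: ifP => act; last by rewrite /W addn1.
  apply: leq_trans (_ : size ker < W); first by rewrite ltnS index_size.
  by rewrite /W addn1 ltnS size_kernel.
exists x; first by rewrite mem_iota.
apply/hasPn => z; rewrite mem_iota add0n => /= zk.
have k0 : 0 < k by lia.
have q1 : z %/ (2 * k) < 2 * k by rewrite ltn_divLR; lia.
have q2 : z %% (2 * k) < 2 * k by rewrite ltn_pmod // muln_gt0.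
rewrite /clash; set sg := z %/ _; set ta := z %% _.
rewrite !dx // negb_and; case: (boolP (slot (sg * n + p) != 0)) => //= act.
have [vn bv al cl] := fa sg q1 act.
have sker := aker sg q1 act.
rewrite {1 2 3 5}/d act index_mem sker nth_index // al /=.
apply/negP=> /and4P[tact h /eqP eqv]; rewrite /d tact nth_index ?aker // in eqv.
by rewrite (cl ta).
Qed.

End Exchange.

(** * Crossings of the partition tree *)

Section Crossings.
Implicit Types (L : seq (nat * nat * nat)) (x y : nat * nat * nat) (c d p : nat).

Definition orientation y x := (y == x) || (y == ((x.1.2, x.1.1), x.2)).

(** The part of an elimination that does not depend on the numbering of the edges. *)
Definition scheme L := all (fun x => x.1.1 != x.1.2) L && pairwise avoids L.

Lemma scheme_cons x L : scheme (x :: L) =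
  [&& x.1.1 != x.1.2, all (avoids x) L & scheme L].
Proof. by rewrite /scheme /= andbACA -andbA. Qed.

Lemma cross1P y x c d : reflect
  ([/\ y = x, c = x.1.1 & d != x.1.1] \/
   [/\ y = ((x.1.2, x.1.1), x.2), d = x.1.1 & c != x.1.1])
  (y \in cross1 x c d).
Proof.
rewrite /cross1; apply: (iffP idP).
  case: (eqVneq c) => [->|cx]; case: (eqVneq d) => [->|dx] //.
    by rewrite inE => /eqP->; left.
  by rewrite inE => /eqP->; right.
case=> [[-> -> /negbTE->]|[-> -> /negbTE->]]; first by rewrite eqxx inE.
by rewrite eqxx inE.
Qed.

Lemma mem_crossings L y c d : y \in crossings L c d -> exists2 x, x \in L & orientation y x.
Proof.
elim: L c d => //= x L IHL c d; rewrite mem_cat => /orP[/cross1P|/IHL[z zL yz]].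
  by case=> [[-> _ _]|[-> _ _]]; exists x; rewrite ?inE ?eqxx // /orientation eqxx ?orbT.
by exists z; rewrite // inE zL orbT.
Qed.

Lemma crossing_avoids x L y c d : all (avoids x) L -> y \in crossings L c d ->
  (y.1.1 != x.1.1) && (y.1.2 != x.1.1).
Proof.
move=> /allP aL /mem_crossings[z /aL /andP[z1 z2] yz].
by case/orP: yz => /eqP-> /=; rewrite (eq_sym z.1.1) (eq_sym z.1.2) z1 z2.
Qed.

(** A crossing leads away from c and towards d, so that no path leaves its last bag
    or enters its first one. *)
Lemma crossing_ends L y c d : scheme L -> y \in crossings L c d ->
  y.1.1 != d /\ y.1.2 != c.
Proof.
elim: L c d => //= x L IHL c d; rewrite scheme_cons => /and3P[nx ax sL].
rewrite mem_cat => /orP[/cross1P|yL].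
  case=> [[-> -> dx]|[-> -> cx]] /=; first by rewrite eq_sym dx eq_sym.
  by rewrite [_ == c]eq_sym cx eq_sym.
have [yd yc] := IHL _ _ sL yL; have /andP[y1 y2] := crossing_avoids ax yL.
by move: yd yc; rewrite /slide; case: (eqVneq d x.1.1) => [->|_]; case: (eqVneq c x.1.1) => [->|_].
Qed.

(** Each bag is left at most once and entered at most once; this is why a slot of a
    bag can be recorded in a single array cell.  A crossing found now starts or ends
    at the removed leaf, which is on no later edge, and its other end is the new
    position of a token, which crossing_ends excludes. *)
Lemma crossings_unique L c d y y' : scheme L ->
  y \in crossings L c d -> y' \in crossings L c d ->
  y.1.1 = y'.1.1 \/ y.1.2 = y'.1.2 -> y = y'.
Proof.
elim: L c d => //= x L IHL c d; rewrite scheme_cons => /and3P[nx ax sL].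
have new z z' : z \in cross1 x c d -> z' \in crossings L (slide x c) (slide x d) ->
    z.1.1 <> z'.1.1 /\ z.1.2 <> z'.1.2.
  move=> zx zL; have [zd zc] := crossing_ends sL zL.
  have /andP[z1 z2] := crossing_avoids ax zL.
  move: zd zc; rewrite /slide; case/cross1P: zx => [[-> -> /negbTE dx]|[-> -> /negbTE cx]].
    by rewrite eqxx dx => _ zc; split=> E; [rewrite E eqxx in z1 | rewrite E eqxx in zc].
  by rewrite eqxx cx /= => zd _; split=> E; [rewrite E eqxx in zd | rewrite E eqxx in z2].
rewrite !mem_cat => /orP[yx|yL] /orP[y'x|y'L] E.
- case/cross1P: yx => -[-> c1 d1]; case/cross1P: y'x => -[-> c2 d2] //.
    by rewrite c1 eqxx in d2.
  by rewrite c1 eqxx in d2.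
- by have [] := new _ _ yx y'L; case: E.
- by have [] := new _ _ y'x yL; case: E => ->.
- exact: IHL yL y'L E.
Qed.

(** The two ends of an edge carry the same token from its removal on. *)
Lemma settle_joined L x : scheme L -> x \in L -> settle L x.1.1 = settle L x.1.2.
Proof.
elim: L => //= y L IHL; rewrite scheme_cons => /and3P[ny ay sL].
rewrite inE => /predU1P[->|xL].
  by rewrite /slide eqxx [_ == y.1.1]eq_sym (negbTE ny).
have /andP[y1 y2] := allP ay x xL.
by rewrite /slide ![_ == y.1.1]eq_sym (negbTE y1) (negbTE y2) IHL.
Qed.

Lemma walk_leaves (V : eqType) (r : rel V) (A : pred V) u q :
  path r u q -> A u -> ~~ A (last u q) -> exists a b, [/\ r a b, A a & ~~ A b].
Proof.
elim: q u => [|z q IH] u /=; first by move=> _ ->.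
case/andP=> uz pq Au nAl; have [Az|nAz] := boolP (A z); first exact: IH pq Az nAl.
by exists u, z.
Qed.

Definition steps (V : eqType) (r : rel V) L (g : V -> nat) := forall a b, r a b ->
  g a = g b \/ exists2 x, x \in L & x.1 = (g a, g b) \/ x.1 = (g b, g a).

(** Every walk between two bags uses each crossing in its direction.  For the edge
    of the first removed leaf w, a walk from w or to w has to pass between w and its
    neighbour.  For later edges, contract w into its neighbour: the walk becomes a
    walk of the smaller tree. *)
Lemma crossing_walk (V : eqType) (r : rel V) L (g : V -> nat) u0 q :
  scheme L -> path r u0 q -> steps r L g ->
  forall y, y \in crossings L (g u0) (g (last u0 q)) ->
  exists a b, [/\ r a b, g a = y.1.1 & g b = y.1.2].
Proof.
elim: L g => //= x L IHL g; rewrite scheme_cons => /and3P[nx ax sL] pq st y.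
have leave a b : r a b -> (g a == x.1.1) != (g b == x.1.1) -> x.1 = (g a, g b) \/ x.1 = (g b, g a).
  move=> /st[->|[z]]; first by rewrite eqxx.
  rewrite inE => /predU1P[-> //|/(allP ax)/andP[z1 z2]].
  by case=> E; move: z1 z2; rewrite E /= ![x.1.1 == _]eq_sym => /negbTE-> /negbTE->.
rewrite mem_cat => /orP[/cross1P[[-> cx dx]|[-> dx cx]]|yL].
- have [|//|a [b [rab ga gb]]] := @walk_leaves _ r (fun z => g z == x.1.1) u0 q pq.
    by rewrite cx.
  have [|E|E] := leave a b rab; first by rewrite ga (negbTE gb).
    by exists a, b; rewrite E.
  by move: gb; rewrite E eqxx.
- have [||a [b [rab ga gb]]] := @walk_leaves _ r (fun z => g z != x.1.1) u0 q pq.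
  + exact: cx.
  + by rewrite dx eqxx.
  have [|E|E] := leave a b rab; first by rewrite (negbTE ga) (negPn gb).
    by move: ga; rewrite E eqxx.
  by exists a, b; rewrite E.
have [] // := IHL (fun z => slide x (g z)) sL pq _ y yL.
  move=> a b rab; have [->|[z]] := st a b rab; first by left.
  rewrite inE => /predU1P[->|zL] E.
    by left; rewrite /slide; case: E => -> /=; rewrite eqxx; case: eqP.
  right; exists z => //; have /andP[z1 z2] := allP ax z zL.
  by move: z1 z2; rewrite /slide; case: E => -> /=;
     rewrite ![x.1.1 == _]eq_sym => /negbTE-> /negbTE->; [left | right].
move=> a [b [rab ga gb]]; exists a, b.
have /andP[y1 y2] := crossing_avoids ax yL.
have [z zL yz] := mem_crossings yL.
have ny : y.1.1 != y.1.2.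
  have /allP nL : all (fun x => x.1.1 != x.1.2) L by case/andP: sL.
  by case/orP: yz => /eqP->; [|rewrite eq_sym]; apply: nL.
have E : (g a == x.1.1) = (g b == x.1.1).
  have [//|/(leave a b rab) E] := eqVneq (g a == x.1.1) (g b == x.1.1).
  move: ny; rewrite -ga -gb /slide.
  by case: E => E; rewrite E /= eqxx if_same eqxx.
split=> //.
  move: ga; rewrite /slide; case: eqP => // gax ya; move: E; rewrite gax eqxx => /esym gbx.
  by move: ny; rewrite -ya -gb /slide gbx eqxx.
move: gb; rewrite /slide; case: eqP => // gbx yb; move: E; rewrite gbx eqxx => gax.
by move: ny; rewrite -yb -ga /slide gax eqxx.
Qed.

(** Conversely, if the vertices of S within a bag are connected to each other and
    each crossing is bridged inside S, then S connects the two bags: follow the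
    token of the leaf that is removed first across its edge, and recurse. *)
Lemma crossings_connect (V : finType) (r : rel V) (S : pred V) (g : V -> nat) L c d u0 v0 :
  {in S &, forall a b, g a = g b -> connect r a b} ->
  (forall y, y \in crossings L c d -> exists a b,
     [/\ a \in S, b \in S, g a = y.1.1, g b = y.1.2 & connect r a b]) ->
  settle L c = settle L d -> u0 \in S -> v0 \in S -> g u0 = c -> g v0 = d ->
  connect r u0 v0.
Proof.
move=> bag_conn; elim: L c d u0 v0 => [|x L IHL] c d u0 v0 /= cr E xS yS gx gy.
  by apply: bag_conn; rewrite // gx gy.
have [cd|ncd] := eqVneq c d; first by apply: bag_conn; rewrite // gx gy.
have crL y : y \in crossings L (slide x c) (slide x d) -> exists a b,
     [/\ a \in S, b \in S, g a = y.1.1, g b = y.1.2 & connect r a b].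
  by move=> yL; apply: cr; rewrite mem_cat yL orbT.
have [cx|ncx] := eqVneq c x.1.1.
  have [|a [b [aS bS ga gb ab]]] := cr x.
    by rewrite mem_cat; apply/orP; left; apply/cross1P; left; rewrite -cx eq_sym.
  have xa : connect r u0 a by apply: bag_conn; rewrite // gx ga.
  apply: connect_trans (connect_trans xa ab) _.
  by apply: IHL crL E bS yS _ _; rewrite /slide -cx ?eqxx // eq_sym (negbTE ncd).
have [dx|ndx] := eqVneq d x.1.1.
  have [|a [b [aS bS ga gb ab]]] := cr ((x.1.2, x.1.1), x.2).
    by rewrite mem_cat; apply/orP; left; apply/cross1P; right.
  have by0 : connect r b v0 by apply: bag_conn; rewrite // gy gb.
  apply: connect_trans (connect_trans ab by0).
  by apply: IHL crL E xS aS _ _; rewrite /slide -dx ?eqxx ?(negbTE ncd).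
by apply: IHL crL E xS yS _ _; rewrite /slide ?(negbTE ncx) ?(negbTE ndx).
Qed.

End Crossings.

(** * Disjoint paths and feasible bags *)

Lemma lookup_mem ws a : lookup ws a != 0 -> (a, lookup ws a) \in ws.
Proof.
elim/last_ind: ws => [|ws w IH] //; rewrite /lookup foldl_rcons mem_rcons inE.
case: (eqVneq a w.1) => [->|_]; first by case: w => a' v' _; apply/orP; left; apply/eqP.
by move/IH->; rewrite orbT.
Qed.

Lemma lookup_unique ws a v : (a, v) \in ws -> (forall v', (a, v') \in ws -> v' = v) ->
  lookup ws a = v.
Proof.
elim/last_ind: ws => [|ws w IH] // aw uniq_a.
rewrite /lookup foldl_rcons; case: eqP => [Ea|na].
  by apply: uniq_a; rewrite mem_rcons inE Ea; apply/orP; left; case: (w) => ? ?; apply/eqP.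
apply: IH => [|v' av'].
  by move: aw; rewrite mem_rcons inE => /predU1P[E|//]; rewrite -E in na.
by apply: uniq_a; rewrite mem_rcons inE av' orbT.
Qed.

Lemma bounded_choice (T : Type) m (P : nat -> T -> Prop) (t0 : T) :
  (forall i, i < m -> exists x, P i x) -> exists f, forall i, i < m -> P i (f i).
Proof.
elim: m => [|m IHm] H; first by exists (fun=> t0).
have [i im|f Hf] := IHm; first by apply: H; apply: ltnW.
have [x Px] := H m (ltnSn m); exists (fun i => if i == m then x else f i) => i.
rewrite ltnS leq_eqVlt => /predU1P[->|im] /=; first by rewrite eqxx; exact: Px.
by rewrite (ltn_eqF im); apply: Hf.
Qed.

(** Paths need not be built vertex by vertex: connectivity inside a set of vertices
    yields a simple path within this set. *)
Lemma connect_st_path (V : finType) (r : rel V) x y : connect r x y ->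
  exists2 q, st_path r x y q & {subset q <= [predU1 x & [pred z | [exists u, r u z]]]}.
Proof.
case/connectP=> q; case/shortenP=> q' pq' uq' _ ->.
exists (x :: q'); first by split.
elim: q' x pq' {uq'} => [|z q' IH] x /=; first by move=> _ z; rewrite !inE => ->.
case/andP=> xz pq' u; rewrite !inE => /predU1P[->|]; first by rewrite eqxx.
rewrite -in_cons => /(IH z pq'); rewrite !inE => /predU1P[->|->]; last by rewrite orbT.
by apply/orP; right; apply/existsP; exists x.
Qed.

Section Correctness.
Variables (n k M : nat) (e : rel 'I_n) (X : 'I_k -> 'I_n * 'I_n) (U : 'I_k -> {set 'I_n}).
Variables (bag s t dom ex ey bd : nat -> nat) (L : seq (nat * nat * nat)).
Hypothesis leMn : M <= n.
Hypothesis e_sym : symmetric e.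
Hypothesis s_E : forall i : 'I_k, s i = (X i).1.
Hypothesis t_E : forall i : 'I_k, t i = (X i).2.
Hypothesis dom_E : forall (i : 'I_k) (v : 'I_n), (dom (i * n + v) != 0) = (v \in U i).
Hypothesis bag_lt : forall v, v < n -> bag v < M.
Hypothesis ex_lt : forall j, j < M -> ex j < M.
Hypothesis ey_lt : forall j, j < M -> ey j < M.
Hypothesis clique : forall x y : 'I_n, bag x = bag y -> x != y -> e x y.
Hypothesis edge_between : forall x y : 'I_n, e x y -> bag x != bag y ->
  exists2 j, j < M & (bag x, bag y) = (ex j, ey j) \/ (bag x, bag y) = (ey j, ex j).
Hypothesis bd_E : forall j (x y : 'I_n), j < M -> ex j != ey j ->
  bag x = ex j -> bag y = ey j -> e x y = (bd (j * n + x) != 0) && (bd (j * n + y) != 0).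
Hypothesis full_L : full_elimination M ex ey L.
Hypothesis settle_L : forall p q, p < M -> q < M -> settle L p = settle L q.

Local Notation slot := (lookup (slot_writes n bag s t L k)).
Local Notation allow := (allowed n k bag s t dom bd slot).
Local Notation term := (terminals s t k).
Local Notation cross i := (crossings L (bag (s i)) (bag (t i))).

Lemma scheme_L : scheme L.
Proof.
have [[jL pL _] _] := full_L; rewrite /scheme pL andbT.
by apply/allP => x /jL[].
Qed.

Lemma cross_joins i y : y \in cross i -> joins M ex ey y.
Proof.
case/mem_crossings=> x xL; have [[jL _ _] _] := full_L; have [xM nx Ex] := jL x xL.
case/orP=> /eqP-> //; split=> //=; first by rewrite eq_sym.
by case: Ex => ->; [right | left].
Qed.

Lemma cross_lt i y : y \in cross i -> y.1.1 < M /\ y.1.2 < M.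
Proof.
case/cross_joins=> yM _ E; have [] := (ex_lt yM, ey_lt yM).
by case: E => ->.
Qed.

Definition at_end b (y : nat * nat * nat) := if b : bool then y.1.1 else y.1.2.

Lemma slot_writesP i (b : bool) p v : i < k -> p < n ->
  reflect (exists y, [/\ y \in cross i, at_end b y = p & v = y.2.+1])
    (((2 * i + b) * n + p, v) \in slot_writes n bag s t L k).
Proof.
move=> ik pn; apply: (iffP flatten_mapP) => [[i' i'k /flatten_mapP[y yc]]|[y [yc yp ->]]].
  have [y1 y2] := cross_lt yc; rewrite !inE !xpair_eqE.
  have y1n := leq_trans y1 leMn; have y2n := leq_trans y2 leMn.
  rewrite -[2 * i' in X in _ || X]addn0 !pair_inj // => /orP[]/andP[/andP[/eqP Ei /eqP Ep] /eqP ->].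
    have [-> ->] : i = i' /\ b = true by case: (b) Ei => /=; lia.
    by exists y.
  have [-> ->] : i = i' /\ b = false by case: (b) Ei => /=; lia.
  by exists y.
exists i; first by rewrite mem_iota.
apply/flatten_mapP; exists y => //; rewrite /writes -yp.
by case: (b); rewrite !inE /= ?addn0 eqxx ?orbT.
Qed.

Lemma slotP i (b : bool) p j : i < k -> p < n ->
  (slot ((2 * i + b) * n + p) = j.+1) <->
  (exists y, [/\ y \in cross i, at_end b y = p & j = y.2]).
Proof.
move=> ik pn; split=> [E|[y [yc yp ->]]].
  have : slot ((2 * i + b) * n + p) != 0 by rewrite E.
  move/lookup_mem/(slot_writesP _ _ ik pn) => [y [yc yp]]; rewrite E => -[->].
  by exists y.
apply: lookup_unique; first by apply/slot_writesP => //; exists y.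
move=> v' /(slot_writesP _ _ ik pn)[y' [yc' yp' ->]]; congr (_ .+1).
suff -> : y' = y by [].
apply: (crossings_unique scheme_L yc' yc); rewrite -yp in yp'.
by move: yp'; rewrite /at_end; case: (b); [left | right].
Qed.

Lemma slot_neq0 i (b : bool) p : i < k -> p < n -> slot ((2 * i + b) * n + p) != 0 ->
  exists y, [/\ y \in cross i, at_end b y = p & slot ((2 * i + b) * n + p) = y.2.+1].
Proof.
move=> ik pn; case E: (slot _) => [//|j] _.
by have [y [yc yp ->]] := (slotP b j ik pn).1 E; exists y.
Qed.

Lemma boundary_crossing i y (a b : 'I_n) : y \in cross i ->
  bag a = y.1.1 -> bag b = y.1.2 ->
  e a b = (bd (y.2 * n + a) != 0) && (bd (y.2 * n + b) != 0).
Proof.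
move=> yc ba bb; have [yM ny E] := cross_joins yc.
case: E => Ey; move: ba bb ny; rewrite Ey /= => ba bb ny; first exact: bd_E.
by rewrite e_sym andbC; apply: bd_E => //; rewrite eq_sym.
Qed.

Lemma slot_decode sg : sg < 2 * k -> exists i b, [/\ i < k, sg = 2 * i + (b : bool) & sg %/ 2 = i].
Proof.
move=> sk; exists (sg %/ 2), (odd sg); split=> //; first by rewrite ltn_divLR // mulnC.
by rewrite mulnC [sg in LHS](divn_eq sg 2) modn2.
Qed.

Lemma allowedE sg v : v < n -> allow (sg * n + v) =
  [&& slot (sg * n + bag v) != 0, dom (sg %/ 2 * n + v) != 0,
    bd ((slot (sg * n + bag v)).-1 * n + v) != 0 &
    [|| ~~ term v, v == s (sg %/ 2) | v == t (sg %/ 2)]].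
Proof.
move=> vn; have n0 : 0 < n by lia.
by rewrite /allowed divnMDl // (divn_small vn) addn0 modnMDl (modn_small vn).
Qed.

Lemma terminalP v : reflect (exists i : 'I_k, (X i).1 = v :> nat \/ (X i).2 = v :> nat) (term v).
Proof.
apply: (iffP hasP) => [[i]|[i E]].
  rewrite mem_iota add0n => /= ik /orP[]/eqP <-; exists (Ordinal ik).
    by left; rewrite -s_E.
  by right; rewrite -t_E.
exists (val i); first by rewrite mem_iota ltn_ord.
by rewrite s_E t_E; case: E => ->; rewrite eqxx ?orbT.
Qed.

Local Notation feasible := (feasible n k bag slot allow term).

(** For each crossing of path i, the walk Q i through the bags has an edge from its
    first bag to its second one, and the ends of this edge fill the two slots.  A
    vertex in slots of two paths is an end of both by internal disjointness. *)
Lemma feasible_of_paths : set_restricted_disjoint_paths e X U ->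
  terminals_in_domains n k s t dom /\ forall p, p < M -> exists a, feasible p a.
Proof.
case=> Q [stQ disjQ].
have endQ i : (X i).1 \in Q i /\ (X i).2 \in Q i.
  have [[_ _ hd lt] _] := stQ i.
  case: (Q i) hd lt => //= x q [->] <-.
  by rewrite mem_head mem_last.
have meetQ i j x : i != j -> x \in Q i -> x \in Q j -> x == (X i).1 \/ x == (X i).2.
  move=> ij xi xj; have [+ _] := disjQ i j ij; move/(_ x xi).
  have [|_] := eqVneq x (X i).1; first by left.
  have [|_] := eqVneq x (X i).2; first by right.
  by move/(_ isT isT); rewrite xj.
have termQ i x : x \in Q i -> term x -> x == (X i).1 \/ x == (X i).2.
  move=> xi /terminalP[j jx]; have [<-|nij] := eqVneq j i.
    by case: jx => /val_inj ->; [left | right].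
  apply: (meetQ _ j) => //; first by rewrite eq_sym.
  by have [] := endQ j; case: jx => /val_inj ->.
split.
  apply/allP => i; rewrite mem_iota add0n => /= ik.
  rewrite (s_E (Ordinal ik)) (t_E (Ordinal ik)) !(dom_E (Ordinal ik)).
  by have [_ sub] := stQ (Ordinal ik); have [? ?] := endQ (Ordinal ik); rewrite !sub.
move=> p pM; have pn := leq_trans pM leMn.
have [a aP] : exists a : nat -> nat, forall sg, sg < 2 * k -> slot (sg * n + p) != 0 ->
    exists2 i : 'I_k, sg %/ 2 = i & exists2 v : 'I_n, a sg = v &
    [/\ bag v = p, v \in Q i & allow (sg * n + v)].
  apply: (@bounded_choice _ (2 * k) (fun sg (w : nat) => slot (sg * n + p) != 0 ->
    exists2 i : 'I_k, sg %/ 2 = i & exists2 v : 'I_n, w = v &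
    [/\ bag v = p, v \in Q i & allow (sg * n + v)]) 0) => sg sk.
  have [|act] := eqVneq (slot (sg * n + p)) 0; first by exists 0.
  have [i [b [ik Esg hsg]]] := slot_decode sk; rewrite Esg in act.
  have [y [yc yp Ey]] := slot_neq0 ik pn act.
  pose io := Ordinal ik; have [[pathQ uQ hd lt] sub] := stQ io.
  have [q EQ] : exists q, Q io = (X io).1 :: q by case: (Q io) hd => //= x q [->]; exists q.
  rewrite EQ /= in pathQ lt.
  pose r x y := [&& e x y, x \in Q io & y \in Q io].
  have rQ : path r (X io).1 q.
    have : all [in Q io] ((X io).1 :: q) by rewrite -EQ; apply/allP.
    move: ((X io).1) pathQ => x; elim: q x {EQ lt} => //= z q IH x /andP[xz pq].
    by case/and3P=> xQ zQ qQ; rewrite /r xz xQ zQ IH //= zQ.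
  have stepr : steps r L (fun v : 'I_n => bag v).
    move=> x z /and3P[exz _ _]; have [|nb] := eqVneq (bag x) (bag z); first by left.
    right; have [j jM E] := edge_between exz nb.
    have nxy : ex j != ey j by case: E => -[<- <-] //; rewrite eq_sym.
    have [[jL _ _] fullE] := full_L; have /mapP[w wL Ej] := fullE j jM nxy.
    exists w => //; have [_ _] := jL w wL; rewrite -Ej.
    by case: E => -[-> ->] [] ->; [left | right | right | left].
  have [|x [z [/and3P[exz xQ zQ] bx bz]]] := crossing_walk scheme_L rQ stepr (y := y).
    by rewrite lt -s_E -t_E.
  pose v := if b then x else z.
  have vQ : v \in Q io by rewrite /v; case: (b).
  have bv : bag v = p by rewrite /v -yp; case: (b).
  exists v => _; exists io; first by rewrite hsg.
  exists v => //; split=> //.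
  rewrite allowedE // bv Esg Ey -Esg hsg /=.
  rewrite (dom_E io) sub //=.
  have := boundary_crossing yc bx bz; rewrite exz => /esym/andP[bdx bdz].
  apply/andP; split; first by rewrite /v; case: (b).
  rewrite (s_E io) (t_E io); case: (boolP (term v)) => //= tv.
  by have [] := termQ io v vQ tv => /eqP ->; rewrite eqxx ?orbT.
exists a => sg sk act; have [i hi [v -> [bv vQ al]]] := aP sg sk act.
split=> // ta tk tact; have [j hj [w -> [bw wQ _]]] := aP ta tk tact.
rewrite hi hj => nij /val_inj vw; rewrite -vw in wQ.
have [] := meetQ i j v _ vQ wQ; first by apply: contraNneq nij => ->.
  by move/eqP->; apply/terminalP; exists i; left.
by move/eqP->; apply/terminalP; exists i; right.
Qed.

(** The chosen vertices of path i together with its ends form a set S i that is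
    connected: bags are cliques and the two boundaries along a tree edge are
    completely joined.  A common vertex of S i and S j that is not an end of path i
    is not a terminal, as the slots of path i allow no terminals of other paths;
    hence it would sit in slots of both, against feasibility. *)
Lemma paths_of_feasible : terminals_in_domains n k s t dom ->
  (forall p, p < M -> exists a, feasible p a) -> set_restricted_disjoint_paths e X U.
Proof.
move=> /allP domT feas.
have [A fA] := @bounded_choice _ M feasible id feas.
pose chosen i (v : 'I_n) (b : bool) :=
  (slot ((2 * i + b) * n + bag v) != 0) && (A (bag v) (2 * i + b) == v :> nat).
pose S (i : 'I_k) := [pred v | [|| v == (X i).1, v == (X i).2 | [exists b, chosen i v b]]].
have domS (i : 'I_k) v : v \in S i -> v \in U i.
  have := domT i; rewrite mem_iota ltn_ord => /(_ isT).
  rewrite s_E t_E !dom_E => /andP[sU tU].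
  rewrite inE => /or3P[/eqP->|/eqP->|/existsP[b /andP[act /eqP Av]]] //.
  have sk : 2 * i + b < 2 * k by have := ltn_ord i; lia.
  have [_ _ al _] := fA _ (bag_lt (ltn_ord v)) _ sk act.
  move: al; rewrite Av allowedE // => /and4P[_ + _ _].
  have -> : (2 * i + b) %/ 2 = i by case: (b) => /=; lia.
  by rewrite dom_E.
have conn i : connect [rel x y | [&& e x y, x \in S i & y \in S i]] (X i).1 (X i).2.
  have sS : (X i).1 \in S i by rewrite inE eqxx.
  have tS : (X i).2 \in S i by rewrite inE eqxx orbT.
  have sM : bag (s i) < M by rewrite s_E; apply: bag_lt.
  have tM : bag (t i) < M by rewrite t_E; apply: bag_lt.
  apply: (@crossings_connect _ _ (mem (S i)) (fun v : 'I_n => bag v) L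
    (bag (s i)) (bag (t i))) => //.
  - move=> a b aS bS ab; have [->|nab] := eqVneq a b; first exact: connect0.
    by apply: connect1; apply/and3P; split=> //; apply: clique.
  - move=> y yc; have [y1 y2] := cross_lt yc.
    have pick (b : bool) p : p < M -> at_end b y = p -> exists v : 'I_n,
        [/\ v \in S i, bag v = p & bd (y.2 * n + v) != 0].
      move=> pM yp; have pn := leq_trans pM leMn.
      have sl : slot ((2 * i + b) * n + p) = y.2.+1.
        by apply/slotP => //; exists y.
      have act : slot ((2 * i + b) * n + p) != 0 by rewrite sl.
      have sk : 2 * i + b < 2 * k by have := ltn_ord i; lia.
      have [vn vp al _] := fA p pM _ sk act.
      exists (Ordinal vn); split=> //.
        rewrite inE; apply/or3P/Or33/existsP; exists b.
        by rewrite /chosen /= vp act eqxx.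
      by move: al; rewrite allowedE // vp sl => /and4P[_ _ +].
    have [a [aS ba bda]] := pick true _ y1 erefl.
    have [b [bS bb bdb]] := pick false _ y2 erefl.
    exists a, b; split=> //; apply: connect1; apply/and3P; split=> //.
    by rewrite (boundary_crossing yc ba bb) bda bdb.
  - exact: settle_L.
  - by rewrite s_E.
  - by rewrite t_E.
have [Q QP] : exists Q : 'I_k -> seq 'I_n, forall i,
    st_path e (X i).1 (X i).2 (Q i) /\ {subset Q i <= S i}.
  apply: (@fin_all_exists _ (fun _ => seq 'I_n)
    (fun i q => st_path e (X i).1 (X i).2 q /\ {subset q <= S i})) => i.
  have [q [pq uq hq lq] sub] := connect_st_path (conn i); exists q; split.
    split=> //; case: q pq {uq hq lq sub} => //= x q.
    by apply: sub_path => y z /andP[].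
  move=> v /sub; rewrite !inE => /predU1P[->|/existsP[u /and3P[_ _]]]; first by rewrite eqxx.
  by rewrite inE.
exists Q; split=> [i|i j nij].
  by have [? sub] := QP i; split=> // v /sub/domS.
have disj (i1 i2 : 'I_k) : i1 != i2 -> forall x, x \in Q i1 ->
    x != (X i1).1 -> x != (X i1).2 -> x \notin Q i2.
  move=> n12 x x1 ns nt; apply/negP => x2.
  have := (QP i1).2 x x1; rewrite inE (negbTE ns) (negbTE nt) /= => /existsP[b /andP[act /eqP Av]].
  have xM := bag_lt (ltn_ord x).
  have hk (l : 'I_k) (c : bool) : (2 * l + c < 2 * k) * ((2 * l + c) %/ 2 = l).
    by split; have := ltn_ord l; case: (c) => /=; lia.
  have [_ _ al cl] := fA _ xM _ (hk i1 b).1 act.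
  have ntx : ~~ term x.
    move: al; rewrite Av allowedE // (hk i1 b).2 s_E t_E => /and4P[_ _ _ /or3P[//|/eqP E|/eqP E]].
      by rewrite (val_inj E) eqxx in ns.
    by rewrite (val_inj E) eqxx in nt.
  move/negP: ntx; apply.
  have := (QP i2).2 x x2; rewrite inE => /or3P[/eqP->|/eqP->|/existsP[c /andP[act' /eqP Av']]].
  - by apply/terminalP; exists i2; left.
  - by apply/terminalP; exists i2; right.
  rewrite -Av; apply: (cl _ (hk i2 c).1 act'); last by rewrite Av Av'.
  by rewrite !(hk _ _).2.
by split; apply: disj => //; rewrite eq_sym.
Qed.

Lemma answerP : answer n k M bag s t dom bd L <-> set_restricted_disjoint_paths e X U.
Proof.
split=> [/andP[domT /allP sol]|/feasible_of_paths[domT feas]].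
  apply: paths_of_feasible => // p pM; apply/solvable_bagP/sol.
  by rewrite mem_iota.
apply/andP; split=> //; apply/allP => p; rewrite mem_iota => /= pM.
by apply/solvable_bagP/feas.
Qed.

End Correctness.

(** * Reading a partition tree from the input arrays *)

Lemma nth_map_enum n (f : 'I_n -> nat) (v : 'I_n) : nth 0 [seq f i | i <- enum 'I_n] v = f v.
Proof. by rewrite (nth_map v) ?size_enum_ord // nth_ord_enum. Qed.

Lemma nth_allpairs (S R : Type) (f : S -> R -> nat) x0 y0 xs ys i j :
  i < size xs -> j < size ys ->
  nth 0 [seq f x y | x <- xs, y <- ys] (i * size ys + j) = f (nth x0 xs i) (nth y0 ys j).
Proof.
elim: xs i => //= x xs IH [|i] ixs jys; rewrite nth_cat size_map.
  by rewrite jys (nth_map y0).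
by rewrite mulSn -addnA ltnNge leq_addr /= addKn IH.
Qed.

Section Forest.
Variables (W : finType) (g : rel W).
Hypotheses (g_sym : symmetric g) (g_irr : irreflexive g) (g_acyc : acyclic_graph g).

(** Without a leaf a simple path could be prolonged for ever: its first vertex has a
    neighbour besides the second one, and this neighbour is not on the path, for it
    would close a cycle of length at least three. *)
Lemma acyclic_leaf : (exists x y, g x y) -> exists x y, g x y /\ forall z, g x z -> z = y.
Proof.
move=> [x0 [y0 xy0]].
have [/existsP[x /existsP[y /andP[xy /forallP H]]]|no] :=
    boolP [exists x, exists y, g x y && [forall z, g x z ==> (z == y)]].
  by exists x, y; split=> // z xz; apply/eqP; apply: (implyP (H z)).
have grow m : exists x y q, [/\ path g x (y :: q), uniq (x :: y :: q) & size q = m].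
  elim: m => [|m [x [y [q [pq uq sq]]]]].
    exists x0, y0, [::]; rewrite /= xy0; split=> //.
    by rewrite inE andbT; apply: contraTneq xy0 => ->; rewrite g_irr.
  have xy : g x y by case/andP: pq.
  have [z xz zy] : exists2 z, g x z & z != y.
    move/existsPn: no => /(_ x)/existsPn/(_ y); rewrite xy /= => /forallPn[z].
    by rewrite negb_imply => /andP[xz zy]; exists z.
  have [zq|nzq] := boolP (z \in x :: y :: q); last first.
    exists z, x, (y :: q); split; last by rewrite /= sq.
      by apply/andP; rewrite g_sym.
    by apply/andP.
  have zx : z != x by apply: contraTneq xz => ->; rewrite g_irr.
  move: zq; rewrite !inE (negbTE zx) (negbTE zy) /= => zq.
  case/splitPr: zq pq uq => q1 q2 pq uq.
  suff: size (x :: y :: rcons q1 z) <= 2 by rewrite /= size_rcons.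
  apply: g_acyc.
    rewrite /= rcons_path last_rcons [g z x]g_sym xz andbT.
    by move: pq; rewrite /= -cat_rcons cat_path andbA => /andP[].
  move: uq; rewrite -cat_rcons.
  by rewrite -!cat_cons cat_uniq => /andP[].
have [x [y [q [_ uq sq]]]] := grow #|W|.
by have := max_card (mem (x :: y :: q)); rewrite (card_uniqP uq) /= sq => /ltnW; rewrite ltnn.
Qed.
End Forest.

Section Bridge.
Variables (n k : nat) (e : rel 'I_n) (X : 'I_k -> 'I_n * 'I_n) (U : 'I_k -> {set 'I_n}).
Variables (P : {set {set 'I_n}}) (T : rel {set 'I_n}).
Variables (Ps : seq {set 'I_n}) (Es : seq ({set 'I_n} * {set 'I_n})).
Hypothesis e_simple : simple_graph [set: 'I_n] e.
Hypothesis pt : partition_tree e P T.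
Hypothesis enumP : enumerates_parts P Ps.
Hypothesis enumE : enumerates_edges T Es.

Local Notation M := (size Ps).
Local Notation "'tab' r" := (arr (input e X U Ps Es) r) (at level 10).
Local Notation bag := (tab 0).
Local Notation s := (tab 1).
Local Notation t := (tab 2).
Local Notation dom := (tab 3).
Local Notation ex := (tab 5).
Local Notation ey := (tab 6).
Local Notation bd := (tab 7).
Local Notation part p := (nth set0 Ps p).
Local Notation edge j := (nth (set0, set0) Es j).

Lemma parts_le : M <= n.
Proof.
have [uP EP] := enumP; have [partP _ _ _ _] := pt.
have -> : M = #|P| by rewrite -(card_uniqP uP); apply: eq_card.
apply: leq_trans (_ : #|[set: 'I_n]| <= n); last by rewrite cardsT card_ord.
rewrite (card_partition partP) -sum1_card; apply: leq_sum => A AP.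
rewrite card_gt0; case/and3P: partP => _ _; apply: contraNneq => <- //.
Qed.

Lemma bagE (v : 'I_n) : bag v = find (fun A : {set 'I_n} => v \in A) Ps.
Proof. exact: (nth_map_enum (fun v : 'I_n => find (fun A : {set 'I_n} => v \in A) Ps)). Qed.

Lemma has_part (v : 'I_n) : has (fun A : {set 'I_n} => v \in A) Ps.
Proof.
have [_ EP] := enumP; have [/and3P[/eqP cov _ _] _ _ _ _] := pt.
have : v \in cover P by rewrite cov inE.
by case/bigcupP=> A AP vA; apply/hasP; exists A; rewrite ?EP.
Qed.

Lemma bag_lt v : v < n -> bag v < M.
Proof. by move=> vn; rewrite (bagE (Ordinal vn)) -has_find has_part. Qed.

Lemma mem_bag (v : 'I_n) : v \in part (bag v).
Proof. by rewrite bagE; apply: (nth_find set0 (has_part v)). Qed.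

Lemma part_in p : p < M -> part p \in P.
Proof. by have [_ EP] := enumP => pM; rewrite -EP mem_nth. Qed.

Lemma bag_eq p (v : 'I_n) : p < M -> v \in part p -> bag v = p.
Proof.
move=> pM vp; have [uP EP] := enumP; have [partP _ _ _ _] := pt.
have bM := bag_lt (ltn_ord v).
apply/eqP; rewrite -(nth_uniq set0 bM pM uP).
have tP := partition_trivIset partP.
by rewrite -(def_pblock tP (part_in bM) (mem_bag v)) -(def_pblock tP (part_in pM) vp).
Qed.

Lemma index_part A : A \in P -> index A Ps < M /\ part (index A Ps) = A.
Proof. by have [_ EP] := enumP; rewrite -EP => AP; rewrite index_mem nth_index. Qed.

Lemma T_parts A C : T A C -> [/\ A \in P, C \in P & A != C].
Proof.
have [_ [[_ T_irr TP] _ _] _ _ _] := pt => AC.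
have /andP[? ?] := TP _ _ AC; split=> //.
by apply: contraTneq AC => ->; rewrite T_irr.
Qed.

Lemma T_sym : symmetric T. Proof. by have [_ [[]]] := pt. Qed.

Lemma edge_T j : j < size Es -> T (edge j).1 (edge j).2.
Proof.
move=> jE; have [_ TE _] := enumE; rewrite TE.
by have := mem_nth (set0, set0) jE; case: (edge j) => ? ? ->.
Qed.

Lemma exE j : j < size Es -> ex j = index (edge j).1 Ps.
Proof. by move=> jE; rewrite /= (nth_map (set0, set0)). Qed.

Lemma eyE j : j < size Es -> ey j = index (edge j).2 Ps.
Proof. by move=> jE; rewrite /= (nth_map (set0, set0)). Qed.

Lemma part_ends j : j < size Es ->
  [/\ ex j < M, ey j < M, part (ex j) = (edge j).1 & part (ey j) = (edge j).2].
Proof.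
move=> jE; have [AP CP _] := T_parts (edge_T jE).
rewrite exE // eyE //.
by have [? ?] := index_part AP; have [? ?] := index_part CP.
Qed.

Lemma ends_neq j : (ex j != ey j) = (j < size Es).
Proof.
case: ltnP => jE; last by rewrite /= !nth_default ?size_map ?eqxx.
have [_ _ AC] := T_parts (edge_T jE); have [_ _ E1 E2] := part_ends jE.
by apply: contraNneq AC => E; rewrite -E1 -E2 E.
Qed.

Lemma T_edge A C : T A C -> exists2 j, j < size Es & edge j = (A, C) \/ edge j = (C, A).
Proof.
have [_ TE _] := enumE; rewrite TE => /orP[]H; have := H; rewrite -index_mem => jE.
  by exists (index (A, C) Es) => //; left; rewrite nth_index.
by exists (index (C, A) Es) => //; right; rewrite nth_index.
Qed.

Lemma edge_inj i j A C : i < size Es -> j < size Es ->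
  edge i = (A, C) \/ edge i = (C, A) -> edge j = (A, C) \/ edge j = (C, A) -> i = j.
Proof.
move=> iE jE; have [uE _ asymE] := enumE.
have mi := mem_nth (set0, set0) iE; have mj := mem_nth (set0, set0) jE.
have same : edge i = edge j -> i = j by move/eqP; rewrite nth_uniq // => /eqP.
case=> Ei [] Ej; try (by apply: same; rewrite Ei Ej);
  by move: mi mj; rewrite Ei Ej => /asymE/negbTE->.
Qed.

(** Any set of tree edges is again acyclic, and the leaf that acyclic_leaf provides
    has degree one in the arrays because Es lists each edge once. *)
Lemma forest N (F : pred nat) : (exists2 j, j < N & F j /\ ex j != ey j) ->
  exists2 p, p < M & deg N ex ey F p = 1.
Proof.
move=> [j0 j0N [Fj0 nj0]].
pose g A C := [exists j : 'I_N, [&& F j, j < size Es & (edge j == (A, C)) || (edge j == (C, A))]].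
have gT A C : g A C -> T A C.
  case/existsP=> j /and3P[_ jE /orP[]/eqP Ej]; have := edge_T jE; rewrite Ej //.
  by rewrite T_sym.
have [_ [[_ T_irr _] _ acycT] _ _ _] := pt.
have [||||x [y [/existsP[j /and3P[Fj jE Ej]] leaf]]] := @acyclic_leaf _ g.
- move=> A C; apply/existsP/existsP => -[j H]; exists j; by rewrite orbC.
- by move=> A; apply: contraFF (T_irr A) => /gT.
- move=> c cg; apply: acycT; case: c cg => //= a c; apply: sub_path => A C; exact: gT.
- exists (edge j0).1, (edge j0).2; apply/existsP; exists (Ordinal j0N) => /=.
  by rewrite Fj0 -ends_neq nj0 -surjective_pairing eqxx.
have {}Ej : edge j = (x, y) \/ edge j = (y, x) by case/orP: Ej => /eqP; [left | right].
have xP : x \in P by have := T_parts (edge_T jE); case: Ej => -> [].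
have [xM px] := index_part xP; exists (index x Ps) => //.
have [_ _ e1 e2] := part_ends jE.
have [-> _] := deg_rem ex ey (index x Ps) (ltn_ord j) Fj.
have -> : inc ex ey j (index x Ps).
  rewrite /inc ends_neq jE exE // eyE //.
  by case: Ej => -> /=; rewrite eqxx ?orbT.
rewrite [deg _ _ _ _ _]big1 // => i /andP[Fi nij].
apply/eqP; rewrite eqb0; apply/negP => /andP[]; rewrite ends_neq => iE ix.
have [_ _ e1' e2'] := part_ends iE.
have xi : x = (edge i).1 \/ x = (edge i).2.
  by case/orP: ix => /eqP E; [left | right]; rewrite -px E.
case/eqP: nij; apply: (edge_inj iE jE _ Ej).
have gi z : edge i = (x, z) \/ edge i = (z, x) -> z = y.
  move=> H; apply: leaf; apply/existsP; exists i; rewrite Fi iE /=.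
  by case: H => ->; rewrite eqxx ?orbT.
move: gi; case: (edge i) xi => a c /= [] -> gi.
  by left; rewrite (gi c) //; left.
by right; rewrite (gi a) //; right.
Qed.

(** Remove the edges one at a time, each together with a leaf of what remains: these
    leaves are distinct. *)
Lemma edges_le : size Es <= M.
Proof.
set E := size Es.
have: forall c rs, size rs = c -> uniq rs -> {subset rs <= gtn E} ->
    exists ws, [/\ uniq ws, size ws = c &
      forall w, w \in ws -> w < M /\ deg E ex ey [in rs] w != 0].
  elim=> [|c IHc] rs crs urs rsE; first by exists [::].
  have [|w wM d1] := @forest E [in rs].
    case: rs crs rsE {urs} => //= j rs _ rsE; have jE := rsE j (mem_head _ _).
    by exists j => //; rewrite mem_head ends_neq.
  have [jE Fj ij d0] := deg1_edge_sum d1; set j := edge_sum _ _ _ _ _ in jE Fj ij d0.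
  have dE v := (deg_rem ex ey v jE Fj).1.
  have remE : [in rem j rs] =1 (fun i => (i \in rs) && (i != j)).
    by move=> i; rewrite /= mem_rem_uniq // inE andbC.
  have [||i /mem_rem/rsE//|ws [uw sw dw]] := IHc (rem j rs).
  - by rewrite size_rem // crs.
  - exact: rem_uniq.
  exists (w :: ws); split=> [||v]; rewrite ?inE /= ?sw //.
    by rewrite uw andbT; apply/negP => /dw[_]; rewrite (eq_deg _ _ _ remE) d0.
  case/predU1P=> [->|/dw[vM dv]]; first by rewrite d1.
  by split=> //; rewrite dE addn_eq0 negb_and -(eq_deg _ _ _ remE) dv orbT.
move/(_ _ (iota 0 E) erefl (iota_uniq _ _)) => [i|ws [uw]].
  by rewrite mem_iota.
rewrite size_iota => <- dw.
rewrite -[M](size_iota 0); apply: uniq_leq_size => // w /dw[wM _].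
by rewrite mem_iota.
Qed.

Lemma settle_bags L : full_elimination M ex ey L ->
  forall p q, p < M -> q < M -> settle L p = settle L q.
Proof.
move=> [[jL aL uL] fullL] p q pM qM.
have [_ [_ [_ conn] _] _ _ _] := pt.
have sL : scheme L by rewrite /scheme aL andbT; apply/allP => x /jL[].
have step A C : T A C -> settle L (index A Ps) = settle L (index C Ps).
  case/T_edge=> j jE Ej; have jM := leq_trans jE edges_le.
  have /mapP[x xL Ex] : j \in edges_of L by apply: fullL; rewrite // ends_neq.
  have [_ _] := jL x xL; rewrite -Ex exE // eyE // => Exy.
  have := settle_joined sL xL.
  by case: Ej Exy => -> /= [] -> /=.
pose S := [pred A | settle L (index A Ps) == settle L p].
have clS : closed T S by move=> A C /step E; rewrite !inE E.
have [uP _] := enumP.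
have := closed_connect clS (conn _ _ (part_in pM) (part_in qM)).
by rewrite !inE !index_uniq // eqxx => /esym/eqP.
Qed.

Lemma sE (i : 'I_k) : s i = (X i).1.
Proof. exact: (nth_map_enum (fun i => val (X i).1)). Qed.

Lemma tE (i : 'I_k) : t i = (X i).2.
Proof. exact: (nth_map_enum (fun i => val (X i).2)). Qed.

Lemma domE (i : 'I_k) (v : 'I_n) : (dom (i * n + v) != 0) = (v \in U i).
Proof.
have := nth_allpairs (fun (i : 'I_k) (v : 'I_n) => nat_of_bool (v \in U i)) i v
  (i := i) (j := v) (xs := enum 'I_k) (ys := enum 'I_n).
rewrite !size_enum_ord !nth_ord_enum => /(_ (ltn_ord _) (ltn_ord _)) E.
by rewrite /= E; case: (v \in U i).
Qed.

Lemma bdE j (v : 'I_n) : j < size Es -> (bd (j * n + v) != 0) =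
  (v \in boundary e (edge j).1 (edge j).2 :|: boundary e (edge j).2 (edge j).1).
Proof.
move=> jE; have := nth_allpairs (fun (A : {set 'I_n} * {set 'I_n}) (v : 'I_n) =>
  nat_of_bool (v \in boundary e A.1 A.2 :|: boundary e A.2 A.1)) (set0, set0) v
  (i := j) (j := v) (xs := Es) (ys := enum 'I_n).
rewrite !size_enum_ord !nth_ord_enum => /(_ jE (ltn_ord _)) E.
by rewrite /= E; case: (v \in _).
Qed.

Lemma clique_bag (x y : 'I_n) : bag x = bag y -> x != y -> e x y.
Proof.
have [_ _ cl _ _] := pt => bxy.
by apply: (cl _ (part_in (bag_lt (ltn_ord x)))); rewrite ?mem_bag // bxy mem_bag.
Qed.

Lemma edge_bags (x y : 'I_n) : e x y -> bag x != bag y ->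
  exists2 j, j < M & (bag x, bag y) = (ex j, ey j) \/ (bag x, bag y) = (ey j, ex j).
Proof.
move=> exy nb; have [bx b_y] := (bag_lt (ltn_ord x), bag_lt (ltn_ord y)).
have [uP _] := enumP; have [_ _ _ _ nonadj] := pt.
have nP : part (bag x) != part (bag y) by rewrite nth_uniq.
have TP : T (part (bag x)) (part (bag y)).
  apply: contraT => nT.
  by have := nonadj _ _ (part_in bx) (part_in b_y) nP nT x y (mem_bag x) (mem_bag y); rewrite exy.
have [j jE Ej] := T_edge TP; exists j; first exact: leq_trans jE edges_le.
by rewrite exE // eyE //; case: Ej => -> /=; rewrite !index_uniq //; [left | right].
Qed.

(** Row j of the boundary table describes both sides of the edge at once, which is
    unambiguous because its two bags are disjoint. *)
Lemma e_bd j (x y : 'I_n) : j < M -> ex j != ey j ->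
  bag x = ex j -> bag y = ey j -> e x y = (bd (j * n + x) != 0) && (bd (j * n + y) != 0).
Proof.
move=> _; rewrite ends_neq => jE bx b_y; rewrite !bdE //.
have [_ _ E1 E2] := part_ends jE; have [e_sym _ _] := e_simple.
have [_ _ _ complete _] := pt.
have xA : x \in (edge j).1 by rewrite -E1 -bx mem_bag.
have yC : y \in (edge j).2 by rewrite -E2 -b_y mem_bag.
have [A' [C' [_ _ eAC]]] := complete _ _ (edge_T jE).
have apart v : v \in (edge j).1 -> v \in (edge j).2 -> False.
  have [eM fM _ _] := part_ends jE.
  rewrite -E1 -E2 => /(bag_eq eM) b1 /(bag_eq fM) b2.
  by have := ends_neq j; rewrite -b1 -b2 eqxx jE.
rewrite !inE xA yC /=.
have -> : (x \in (edge j).2) = false by apply/negP => /(apart _ xA).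
have -> : (y \in (edge j).1) = false by apply/negP => yA; apply: apart yA yC.
rewrite orbF /=; apply/idP/andP => [exy|[]].
  split; apply/existsP; first by exists y; rewrite yC.
  by exists x; rewrite xA e_sym.
case/existsP=> y' /andP[yC' exy'] /existsP[x' /andP[xA' eyx']].
rewrite eAC // in exy'; rewrite e_sym eAC // in eyx'; rewrite eAC //.
by case/andP: exy' => -> _; case/andP: eyx' => _ ->.
Qed.

Lemma ends_lt j : j < M -> ex j < M /\ ey j < M.
Proof.
move=> jM; case: (ltnP j (size Es)) => jE; first by have [] := part_ends jE.
by rewrite /= !nth_default ?size_map //; split; apply: leq_ltn_trans jM.
Qed.

End Bridge.

(** * Time and word bounds *)

(** The factor 2 ^ (3 l + 6) with l the logarithm of k bounds the base 8 k^3 + 1 of the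
    odometer, which has 2 * k positions; the other two terms absorb the factor
    128 (k + 1)^2 of the remaining work. *)
Definition exponent k := (3 * trunc_log 2 k + 6) * (2 * k) + 2 * k + 7.

Lemma exponent_bigO : bigO exponent (fun k => k * trunc_log 2 k).
Proof.
exists 27, 2 => k k2; rewrite /exponent.
have : 1 <= trunc_log 2 k by apply: trunc_log_max.
by case: (trunc_log 2 k) => // l _; nia.
Qed.

Lemma choices_bound k : (8 * k * k * k + 1) ^ (2 * k) <= 2 ^ ((3 * trunc_log 2 k + 6) * (2 * k)).
Proof.
rewrite [leqRHS]expnM; case: (posnP (2 * k)) => [->//|k0]; rewrite leq_exp2r //.
have := trunc_log_ltn k (isT : 1 < 2); set l := trunc_log 2 k => kl.
have -> : 2 ^ (3 * l + 6) = 8 * (2 ^ l.+1 * 2 ^ l.+1 * 2 ^ l.+1).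
  by rewrite -!expnD -[8]/(2 ^ 3) -expnD; congr (2 ^ _); lia.
move: (2 ^ l.+1) kl {k0} => a ka; clear -ka.
have cube : k * k * k < a * a * a by rewrite !ltn_mul.
by rewrite -!mulnA in cube *; lia.
Qed.

Lemma running_time_bound n k M : 0 < n -> M <= n ->
  running_time n k M <= 2 ^ exponent k * n.
Proof.
move=> n0 Mn; rewrite /exponent expnD [2 ^ (_ + 2 * k)]expnD.
have kk : k.+1 * k.+1 <= 2 ^ (2 * k).
  have := ltn_expl k (isT : 1 < 2); by rewrite [2 * k]mulnC expnM expnS expn1 => lt; apply: leq_mul.
have := choices_bound k; rewrite /running_time.
have : 0 < (8 * k * k * k + 1) ^ (2 * k) by rewrite expn_gt0 addn1.
move: (_ ^ (2 * k)) => w; move: (2 ^ (_ * _)) (2 ^ (2 * k)) kk => c a kk w0 wc.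
apply: leq_trans (_ : n * (w * (k.+1 * k.+1) * 2 ^ 7) <= _); last first.
  by rewrite mulnC leq_mul // leq_mul // leq_mul.
have add x y x' y' : x <= n * x' -> y <= n * y' -> x + y <= n * (x' + y').
  by rewrite mulnDr; apply: leq_add.
have nx x : x <= n * x by rewrite leq_pmull.
apply: (@leq_trans (n * ((k * 4 + 2) + (9 + (33 + ((k * 16 + 2) + ((k * 6 + 2) +
  ((k * k * 20 + 11) + ((k * 3 + 3) + ((k * 6 + 8 + w * (k * k * 16 + k * 8 + 10) + 2) + 1)))))))))).
  apply: (add) (nx _) _.
  apply: (add); first by clear -Mn n0; lia.
  apply: (add); first by clear -Mn n0; lia.
  apply: (add).
    apply: (add) _ (nx _); rewrite mulnCA leq_mul2l; apply/orP; right.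
    by clear -Mn n0; lia.
  apply: (add); first by apply: (add) _ (nx _); clear; lia.
  apply: (add).
    have -> : k * k * 20 + 11 = (4 * k * k * 5 + 9) + 2 by clear; lia.
    by apply: (add) (leqnn _) (nx _).
  apply: (add) (nx _) _.
  apply: (add) _ (nx _); apply: (add) _ (nx _).
  have -> : 4 * k * k * 4 + 2 * k * 4 + 10 = k * k * 16 + k * 8 + 10 by clear; lia.
  by apply: leq_mul => //; clear; lia.
apply: leq_mul => //.
have wx x : x <= w * x by rewrite leq_pmull.
apply: (@leq_trans (w * (20 * (k * k) + 35 * k + 73 + (k * k * 16 + k * 8 + 10)))).
  rewrite [leqRHS]mulnDr; apply: leq_trans (leq_add (wx _) (leqnn _)); lia.
rewrite -[leqRHS]mulnA; apply: leq_mul => //; rewrite -[2 ^ 7]/128; clear; lia.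
Qed.

Lemma word_bound n k : 0 < n ->
  n.+2 * n.+2 * (8 * k ^ 3 + 4 * k ^ 2 + 2 * k + 2) < (n + k + 2) ^ 9.
Proof.
move=> n0; set z := n + k + 2.
have [z3 nz kz] : [/\ 3 <= z, n.+2 <= z & k < z] by rewrite /z; split; lia.
have -> : z ^ 9 = z * z * (z ^ 3 * z ^ 3 * z) by rewrite -mulnA -!expnD -expnSr -!expnS.
rewrite -mulnA -[z * z * _]mulnA.
have k3 : k ^ 3 <= z ^ 3 by rewrite leq_exp2r // ltnW.
have k2 : k ^ 2 <= z ^ 3 
  by apply: (@leq_trans (z ^ 2)); [rewrite leq_exp2r // ltnW | rewrite leq_pexp2l //; lia].
have k1 : k <= z ^ 3 by apply: leq_trans (ltnW kz) _; rewrite -{1}[z]expn1 leq_pexp2l //; lia.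
have z27 : 27 <= z ^ 3 by rewrite (@leq_exp2r 3 z 3).
apply: leq_ltn_trans (leq_mul nz (leq_mul nz (leqnn _))) _.
rewrite !ltn_pmul2l; try lia.
move: (k ^ 3) (k ^ 2) (z ^ 3) k3 k2 k1 z27 => a b c; clear -z3; nia.
Qed.

Theorem theorem5p6 :
  exists (A : cmd) (c : nat) (f : nat -> nat),
    bigO f (fun k => k * trunc_log 2 k) /\
    forall (n k : nat) (e : rel 'I_n)
           (X : 'I_k -> 'I_n * 'I_n) (U : 'I_k -> {set 'I_n})
           (P : {set {set 'I_n}}) (T : rel {set 'I_n})
           (Ps : seq {set 'I_n}) (Es : seq ({set 'I_n} * {set 'I_n})),
      well_partitioned_chordal e ->
      partition_tree e P T ->
      enumerates_parts P Ps ->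
      enumerates_edges T Es ->
      exists (t : nat) (m : state),
        [/\ exec ((n + k + 2) ^ c) A (input e X U Ps Es) t m,
            t <= 2 ^ f k * n,
            reg m 0 = 0 \/ reg m 0 = 1
          & reg m 0 = 1 <-> set_restricted_disjoint_paths e X U].
Proof.
exists algorithm, 9, exponent; split; first exact: exponent_bigO.
move=> n k e X U P T Ps Es [e_simple [V0 _] _] pt enumP enumE.
have n0 : 0 < n by case/set0Pn: V0 => v _; apply: leq_ltn_trans (ltn_ord v).
have [e_sym _ _] := e_simple.
have ends := ends_lt X U pt enumP enumE.
set m0 := input e X U Ps Es.
have [t' [m [ex tt' [L full_L ans]]]] :
  runs ((n + k + 2) ^ 9) algorithm m0 (running_time n k (size Ps)) (fun m' =>
    exists2 L, full_elimination (size Ps) (arr m0 5) (arr m0 6) L &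
      reg m' 0 = answer n k (size Ps) (arr m0 0) (arr m0 1) (arr m0 2) (arr m0 3) (arr m0 7) L).
  apply: algorithm_ok.
  - exact: parts_le pt enumP.
  - exact: (bag_lt X U Es pt enumP).
  - by move=> i ik; rewrite (sE e X U Ps Es (Ordinal ik)).
  - by move=> i ik; rewrite (tE e X U Ps Es (Ordinal ik)).
  - by move=> j /ends[].
  - by move=> j /ends[].
  - exact: word_bound.
  - by move=> F /(forest pt enumP enumE)[p _ dp]; exists p.
  - by [].
  (* from number 8 on the arrays are no part of the input and hold only zeros *)
  - by do 8!case=> //; move=> r a _ /=; rewrite nth_nil.
have answer_correct : answer n k (size Ps) (arr m0 0) (arr m0 1) (arr m0 2) (arr m0 3) (arr m0 7) L
    <-> set_restricted_disjoint_paths e X U.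
  apply: (@answerP _ _ _ _ _ _ _ _ _ _ (arr m0 5) (arr m0 6)) => //.
  - exact: parts_le pt enumP.
  - exact: sE.
  - exact: tE.
  - exact: domE.
  - exact: (bag_lt X U Es pt enumP).
  - by move=> j /ends[].
  - by move=> j /ends[].
  - exact: (clique_bag pt enumP).
  - exact: (edge_bags pt enumP enumE).
  - exact: (e_bd e_simple pt enumP enumE).
  - exact: (settle_bags pt enumP enumE full_L).
exists t', m; split=> //.
- exact: (leq_trans tt' (running_time_bound k n0 (parts_le pt enumP))).
- by rewrite ans; case: (answer _ _ _ _ _ _ _ _ _); [right | left].
- by rewrite ans -answer_correct; case: (answer _ _ _ _ _ _ _ _ _).
Qed.
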